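(* Let $D$ be the closed unit disk with $\omega=dx\wedge dy$, $G=\mathrm{Symp}(D)$. Let $\underline{\tau}:G\to\mathbb{R}/\mathbb{Z}$ be the composition of $\overline{\tau}/\pi^2:G\to\mathbb{R}$ with the projection $\mathbb{R}\to\mathbb{R}/\mathbb{Z}$. Then \[ \underline{\tau}+\underline{R}=\mathrm{rot}\quad\text{as maps } G\to\mathbb{R}/\mathbb{Z}, \] where $\mathrm{rot}:G\to\mathbb{R}/\mathbb{Z}$ is the pullback of Poincaré's rotation number by the restriction $G\to\mathrm{Diff}_+(S^1)$.
   Context: $G=\mathrm{Symp}(D)$ is the group of all symplectomorphisms of $D$ (not necessarily the identity on $\partial D$), $\widetilde{G}$ its universal covering group ($C^\infty$-topology), $p:\widetilde G\to G$ the projection. For a $1$-form $\eta$ with $d\eta=\omega$, $\tau_\eta(g)=\int_D g^*\eta\wedge\eta$ is a quasi-morphism and $\overline{\tau}$ its homogenization. For a path $g_t$ in $G$ with $g_0=\mathrm{id}$, let $X_t=(\partial g_t/\partial t)\circ g_t^{-1}$ and $f_{X_t}$ the unique function with $i_{X_t}\omega=df_{X_t}$, $f_{X_t}|_{\partial D}=0$; $R([g_t])=\int_0^1(\int_D f_{X_t}\omega)dt$ is a homomorphism $\widetilde G\to\mathbb{R}$. The composition of $2R/\pi^2$ with $\mathbb{R}\to\mathbb{R}/\mathbb{Z}$ factors through $p$, giving a homomorphism $\underline{R}:G\to\mathbb{R}/\mathbb{Z}$. With $S^1=\partial D=\mathbb{R}/2\pi\mathbb{Z}$, the translation number of a lift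 $\widetilde\varphi$ is $\lim_n\widetilde{\varphi}^n(0)/(2\pi n)$, and the rotation number $\mathrm{rot}:\mathrm{Diff}_+(S^1)\to\mathbb{R}/\mathbb{Z}$ is its reduction mod $\mathbb{Z}$ (independent of the lift). *)

(* Defs.v *)
From Stdlib Require Import Reals List ZArith.
From Coquelicot Require Import Coquelicot.
Open Scope R_scope.

Definition pder (d : nat) (F : R -> R -> R -> R) : R -> R -> R -> R :=
  match d with
  | O => fun t x y => Derive (fun s => F s x y) t
  | S O => fun t x y => Derive (fun s => F t s y) x
  | _ => fun t x y => Derive (fun s => F t x s) y
  end.

Definition has_pder (d : nat) (F : R -> R -> R -> R) (t x y : R) : Prop :=
  match d with
  | O => ex_derive (fun s => F s x y) t
  | S O => ex_derive (fun s => F t s y) x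
  | _ => ex_derive (fun s => F t x s) y
  end.

Fixpoint iter_pder (l : list nat) (F : R -> R -> R -> R) : R -> R -> R -> R :=
  match l with
  | nil => F
  | d :: l' => pder d (iter_pder l' F)
  end.

Definition smooth3 (F : R -> R -> R -> R) : Prop :=
  forall (l : list nat) (t x y : R),
    (forall d, has_pder d (iter_pder l F) t x y) /\
    continuous (fun p : R * R * R => iter_pder l F (fst (fst p)) (snd (fst p)) (snd p))
               (t, x, y).

Definition smooth2 (f : R -> R -> R) : Prop := smooth3 (fun _ x y => f x y).

Definition in_disk (p : R * R) : Prop := fst p ^ 2 + snd p ^ 2 <= 1.
Definition on_circle (p : R * R) : Prop := fst p ^ 2 + snd p ^ 2 = 1.

Definition comp1 (g : R * R -> R * R) (x y : R) : R := fst (g (x, y)).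
Definition comp2 (g : R * R -> R * R) (x y : R) : R := snd (g (x, y)).

Definition dx (f : R -> R -> R) (x y : R) : R := Derive (fun s => f s y) x.
Definition dy (f : R -> R -> R) (x y : R) : R := Derive (fun s => f x s) y.

Definition jac_det (g : R * R -> R * R) (x y : R) : R :=
  dx (comp1 g) x y * dy (comp2 g) x y - dy (comp1 g) x y * dx (comp2 g) x y.

(** g (a smooth self-map of R^2) represents an element of Symp(D), D the closed
    unit disk with omega = dx /\ dy: its restriction to D is a diffeomorphism of D
    (smooth up to the boundary) preserving omega.  Values outside D are irrelevant. *)
Definition is_symp (g : R * R -> R * R) : Prop :=
  smooth2 (comp1 g) /\ smooth2 (comp2 g) /\
  (forall p, in_disk p -> in_disk (g p)) /\
  (forall q, in_disk q -> exists! p, in_disk p /\ g p = q) /\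
  (forall x y, in_disk (x, y) -> jac_det g x y = 1).

Definition disk_int (h : R -> R -> R) : R :=
  RInt (fun x => RInt (fun y => h x y) (- sqrt (1 - x ^ 2)) (sqrt (1 - x ^ 2))) (-1) 1.

(** eta = P dx + Q dy is a smooth 1-form with d eta = omega on D. *)
Definition is_primitive (P Q : R -> R -> R) : Prop :=
  smooth2 P /\ smooth2 Q /\
  (forall x y, in_disk (x, y) -> dx Q x y - dy P x y = 1).

(** tau_eta(g) = int_D g^* eta /\ eta, with g^* eta = A dx + B dy. *)
Definition tau (P Q : R -> R -> R) (g : R * R -> R * R) : R :=
  disk_int (fun x y =>
    let a := P (comp1 g x y) (comp2 g x y) in
    let b := Q (comp1 g x y) (comp2 g x y) in
    let A := a * dx (comp1 g) x y + b * dx (comp2 g) x y in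
    let B := a * dy (comp1 g) x y + b * dy (comp2 g) x y in
    A * Q x y - B * P x y).

Definition tau_bar (P Q : R -> R -> R) (g : R * R -> R * R) : R :=
  real (Lim_seq (fun n => tau P Q (fun p => Nat.iter n g p) / INR n)).

Definition is_symp_isotopy (H : R -> R * R -> R * R) (g : R * R -> R * R) : Prop :=
  smooth3 (fun t x y => fst (H t (x, y))) /\
  smooth3 (fun t x y => snd (H t (x, y))) /\
  (forall t, 0 <= t <= 1 -> is_symp (H t)) /\
  (forall p, in_disk p -> H 0 p = p /\ H 1 p = g p).

(** f t = f_{X_t}: i_{X_t} omega = d f_t on D, f_t = 0 on the boundary, where
    X_t = (d/dt H_t) o H_t^{-1}; i.e. at p = H_t q:
    d_x f_t (p) = - X_t^2 (p), d_y f_t (p) = X_t^1 (p). *)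
Definition is_normalized_ham (H : R -> R * R -> R * R) (f : R -> R -> R -> R) : Prop :=
  smooth3 f /\
  forall t, 0 <= t <= 1 ->
    (forall q, in_disk q ->
       Derive (fun s => f t s (snd (H t q))) (fst (H t q))
         = - Derive (fun s => snd (H s q)) t /\
       Derive (fun s => f t (fst (H t q)) s) (snd (H t q))
         = Derive (fun s => fst (H s q)) t) /\
    (forall p, on_circle p -> f t (fst p) (snd p) = 0).

Definition calabi_R (f : R -> R -> R -> R) : R :=
  RInt (fun t => disk_int (f t)) 0 1.

Definition is_circle_lift (g : R * R -> R * R) (F : R -> R) : Prop :=
  (forall th, continuous F th) /\
  (forall th, g (cos th, sin th) = (cos (F th), sin (F th))).

Definition transl (F : R -> R) : R :=
  real (Lim_seq (fun n => Nat.iter n F 0 / (2 * PI * INR n))).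

(* Main.v *)
(** Write eta = P dx + Q dy and let h_t be the isotopy from the identity to g.
    By Cartan's formula d/dt (h_t^* eta) = h_t^* (d (eta(X_t)) + i_(X_t) omega), so
    phi = int_0^1 (eta(X_t) + f_t) o h_t dt satisfies dphi = g^* eta - eta.
    Stokes' theorem applied to phi eta gives
      tau(g) = oint phi eta - int_D phi omega,
    and int_D phi omega = 2 R, by invariance of area under h_t and Stokes' theorem
    for f_t eta.  On the circle phi is the integral of eta along the boundary path:
    phi = U o F - U, where F is the lift obtained from the isotopy and U is a primitive
    of eta on the universal cover of the circle, so that U(s) = s/2 + O(1).
    The function sum_(k < n) phi o g^k plays the same role for g^n, has integral n 2 R
    and equals U o F^n - U on the circle.  Hence
      tau(g^n) = (pi / 2) F^n(0) - n 2 R + O(1),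
    and dividing by n gives tau_bar + 2 R = pi^2 transl F.  Any other lift differs from
    F by an integer number of turns. *)

Require Import Defs.
From Stdlib Require Import Reals ZArith Lra Lia List Classical ClassicalEpsilon FunctionalExtensionality.
From Coquelicot Require Import Coquelicot.
Open Scope R_scope.

(** * Continuity and differentiation of parametric integrals *)


(** The obstacle is the boundary. The isotopy is controlled only on the closed disk and for times in
    [0, 1], although its components are smooth everywhere. Regularity is therefore used globally and
    identities only on the disk; an equality of derivatives at a boundary point is reached by
    continuity from the interior. That the circle is carried to itself follows from the tangency of
    X_t, by a Gronwall argument. The lift then needs no choice of angle: it integrates the angular
    velocity. Area invariance comes after it, since Green's formula reduces the change of variables
    to the boundary map having degree one. The constants: eta has integral pi over the circle, so U
    gains pi per turn, and the integral of phi eta for the n-th iterate is close to (F^n(0) / 2) pi.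
    The error is uniform in n because a monotone degree-one map, iterates included, displaces all
    points equally up to 2 pi. Finally pi^2 = (pi / 2)(2 pi), the last factor being one full turn.
    [Lim_seq] is total, so genuine convergence of F^n(0) / n is established before any limit is
    evaluated. *)

Definition continuous1 (F : R -> R) : Prop := forall t, continuous F t.
Definition continuous2 (F : R -> R -> R) : Prop :=
  forall p : R * R, continuous (fun p => F (fst p) (snd p)) p.
Definition continuous3 (F : R -> R -> R -> R) : Prop :=
  forall p : R * R * R, continuous (fun p => F (fst (fst p)) (snd (fst p)) (snd p)) p.

Lemma continuous1_comp (F : R -> R) (U : UniformSpace) (a : U -> R) z :
  continuous1 F -> continuous a z -> continuous (fun z => F (a z)) z.
Proof. intros HF Ha; apply (continuous_comp a F); auto. Qed.

Lemma continuous2_comp (F : R -> R -> R) (U : UniformSpace) (a b : U -> R) z :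
  continuous2 F -> continuous a z -> continuous b z -> continuous (fun z => F (a z) (b z)) z.
Proof. intros HF Ha Hb; apply continuous_comp_2; auto. Qed.

Lemma continuous3_comp (F : R -> R -> R -> R) (U : UniformSpace) (a b c : U -> R) z :
  continuous3 F -> continuous a z -> continuous b z -> continuous c z ->
  continuous (fun z => F (a z) (b z) (c z)) z.
Proof.
intros HF Ha Hb Hc.
apply (continuous_comp_2 (fun z => (a z, b z)) c (fun p q => F (fst p) (snd p) q)); auto.
apply (continuous_comp_2 a b (fun p q => (p, q))); auto.
apply (continuous_ext (fun p => p)); [intros []; reflexivity|apply continuous_id].
Qed.

(** Tube lemma: compactness of [a, b] turns joint continuity into continuity at [u] that is uniform
    in [v]. *)
Lemma cont_tube (U : UniformSpace) (F : U -> R -> R) (a b : R) (u : U) (eps : posreal) :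
  (forall p : U * R, continuous (fun p => F (fst p) (snd p)) p) ->
  locally u (fun u' => forall v, a <= v <= b -> Rabs (F u' v - F u v) < eps).
Proof.
intros HF.
assert (Hd : forall v, exists d : posreal, forall u' v', ball u d u' -> Rabs (v' - v) < d ->
   Rabs (F u' v' - F u v) < eps / 2).
{ intros v. destruct (HF (u, v) (fun y => Rabs (y - F u v) < eps / 2)) as [d Hd].
  - exists (pos_div_2 eps). intros y Hy. exact Hy.
  - exists d. intros u' v' H1 H2. apply (Hd (u', v')). split; assumption. }
destruct (choice _ Hd) as [d Hd'].
destruct (compactness_value_1d a b d) as [e He].
(* [compactness_value_1d] delivers its covering point under a double negation, hence the argument by
   contradiction. *)
exists e. intros u' Hu v Hv. apply NNPP. intros Hn. apply (He v Hv).
intros [t [Ht [H1 H2]]]. apply Hn.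
assert (B : ball u (d t) u') by (eapply ball_le; eauto).
assert (K1 := Hd' t u' v B H1).
assert (K2 := Hd' t u v (ball_center _ _) H1).
replace (F u' v - F u v) with ((F u' v - F u t) - (F u v - F u t)) by ring.
apply Rabs_def2 in K1; apply Rabs_def2 in K2. apply Rabs_def1; lra.
Qed.

Lemma section_cont (U : UniformSpace) (F : U -> R -> R) (u : U) :
  (forall p : U * R, continuous (fun p => F (fst p) (snd p)) p) -> continuous1 (F u).
Proof.
intros HF v. apply (continuous_comp (fun v => (u, v)) (fun p => F (fst p) (snd p))); auto.
apply (continuous_comp_2 (fun _ => u) (fun v => v) (fun p q => (p, q))).
- apply continuous_const.
- apply continuous_id.
- apply (continuous_ext (fun p => p)); [intros []; reflexivity|apply continuous_id].
Qed.

Lemma ex_RInt_cont1 (F : R -> R) a b : continuous1 F -> ex_RInt F a b.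
Proof. intros H; apply (ex_RInt_continuous (V := R_CompleteNormedModule)); intros; apply H. Qed.

Lemma cont_RInt_le (U : UniformSpace) (F : U -> R -> R) (a b : R) (u : U) : a <= b ->
  (forall p : U * R, continuous (fun p => F (fst p) (snd p)) p) ->
  continuous (fun u => RInt (F u) a b) u.
Proof.
intros Hab HF. apply filterlim_locally. intros eps.
(* The added 1 keeps the denominator positive when a = b. *)
assert (He : 0 < eps / (b - a + 1)).
{ apply Rdiv_lt_0_compat; [apply cond_pos|lra]. }
generalize (cont_tube U F a b u (mkposreal _ He) HF).
apply filter_imp. intros u' Hu. simpl in Hu.
change (Rabs (RInt (F u') a b - RInt (F u) a b) < eps).
assert (E1 := ex_RInt_cont1 _ a b (section_cont U F u HF)).
assert (E2 := ex_RInt_cont1 _ a b (section_cont U F u' HF)).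
replace (RInt (F u') a b - RInt (F u) a b) with (RInt (fun v => F u' v - F u v) a b).
2: now apply (RInt_minus (V := R_CompleteNormedModule) (F u') (F u)).
eapply Rle_lt_trans.
- apply (abs_RInt_le_const _ a b (eps / (b - a + 1))); auto.
  + now apply (ex_RInt_minus (V := R_CompleteNormedModule) (F u') (F u)).
  + intros t Ht. left. now apply Hu.
- apply Rmult_lt_reg_r with (b - a + 1); [lra|].
  replace ((b - a) * (eps / (b - a + 1)) * (b - a + 1)) with ((b - a) * eps) by (field; lra).
  assert (H := cond_pos eps). nra.
Qed.

Lemma cont_RInt (U : UniformSpace) (F : U -> R -> R) (a b : R) (u : U) :
  (forall p : U * R, continuous (fun p => F (fst p) (snd p)) p) ->
  continuous (fun u => RInt (F u) a b) u.
Proof.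
intros HF. destruct (Rle_or_lt a b).
- now apply cont_RInt_le.
- apply continuous_ext with (fun u => opp (RInt (F u) b a)).
  + intros x. apply (opp_RInt_swap (V := R_CompleteNormedModule)). apply ex_RInt_cont1, section_cont, HF.
  + apply (continuous_opp (V := R_NormedModule)). apply cont_RInt_le; [lra|auto].
Qed.

Lemma continuous1_sin : continuous1 sin. Proof. exact continuous_sin. Qed.
Lemma continuous1_cos : continuous1 cos. Proof. exact continuous_cos. Qed.

(** Continuity by structural descent on the body of the function. Unknown functions are handled by
    hypotheses [continuous1], [continuous2] or [continuous3] found in the context, which is why
    regularity records are destructured before it is called. *)
Ltac cts :=
  intros; unfold Rminus, Rdiv, continuous1, continuous2, continuous3; intros;
  lazymatch goal with
  | |- continuous _ _ => idtac
  end;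
  repeat first [
  lazymatch goal with
  | |- continuous (fun z => z) _ => apply continuous_id
  | |- continuous (fun _ => ?c) _ => apply continuous_const
  | |- continuous (fun z => fst z) _ => apply continuous_fst
  | |- continuous (fun z => snd z) _ => apply continuous_snd
  | |- continuous (fun z => fst (@?p z)) _ => apply (continuous_comp p fst); [|apply continuous_fst]
  | |- continuous (fun z => snd (@?p z)) _ => apply (continuous_comp p snd); [|apply continuous_snd]
  | |- continuous (fun z => (@?p z) + (@?q z)) _ => apply (continuous_plus (V := R_NormedModule) p q)
  | |- continuous (fun z => (@?p z) * (@?q z)) _ => apply (continuous_mult (K := R_AbsRing) p q)
  | |- continuous (fun z => - (@?p z)) _ => apply (continuous_opp (V := R_NormedModule) p)
  | |- continuous (fun z => sin (@?p z)) _ => apply (continuous1_comp sin _ p _ continuous1_sin)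
  | |- continuous (fun z => cos (@?p z)) _ => apply (continuous1_comp cos _ p _ continuous1_cos)
  | |- continuous (fun z => RInt (fun v => @?F z v) ?a ?b) _ =>
      apply (cont_RInt _ F a b); intros; cbv beta
  end
  | match goal with
    | H : continuous3 ?K |- continuous (fun z => ?K (@?a z) (@?b z) (@?c z)) _ =>
       apply (continuous3_comp K _ a b c _ H)
    | H : continuous2 ?K |- continuous (fun z => ?K (@?a z) (@?b z)) _ =>
       apply (continuous2_comp K _ a b _ H)
    | H : continuous1 ?K |- continuous (fun z => ?K (@?a z)) _ =>
       apply (continuous1_comp K _ a _ H)
    | H : continuous1 ?K |- continuous ?K _ => apply H
    | |- continuous ?f ?x => lazymatch f with
        | fun z => _ => fail
        | _ => change (continuous (fun z => f z) x)
        end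
    end ]; cbv beta.

(** Existence of both partial derivatives and continuity of the first give total differentiability
    of [K], to which the composition rule for differentials applies. *)
Lemma chain2 (K Kx Ky : R -> R -> R) (u v : R -> R) (s u' v' : R) :
  (forall x y, is_derive (fun z => K z y) x (Kx x y)) ->
  (forall x y, is_derive (fun z => K x z) y (Ky x y)) ->
  continuous2 Kx -> is_derive u s u' -> is_derive v s v' ->
  is_derive (fun s => K (u s) (v s)) s (Kx (u s) (v s) * u' + Ky (u s) (v s) * v').
Proof.
intros H1 H2 C Hu Hv.
assert (D : filterdiff (fun p : R * R => K (fst p) (snd p)) (locally (u s, v s))
   (fun p : R * R => plus (scal (fst p) (Kx (u s) (v s))) (scal (snd p) (Ky (u s) (v s))))).
{ apply (is_derive_filterdiff K (u s) (v s) Kx (Ky (u s) (v s))).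
  - apply filter_forall. intros p; apply H1.
  - apply H2.
  - apply (C (u s, v s)). }
unfold is_derive.
assert (E := filterdiff_comp'_2 u v K s _ _
  (fun p q => plus (scal p (Kx (u s) (v s))) (scal q (Ky (u s) (v s)))) Hu Hv D).
eapply filterdiff_ext_lin; [exact E|].
intros y. unfold plus, scal; simpl; unfold mult; simpl; ring.
Qed.

Lemma continuous2_section (F : R -> R -> R) x : continuous2 F -> continuous1 (F x).
Proof. intros H; cts. Qed.

Lemma leibniz (F dF : R -> R -> R) (a b u : R) :
  (forall u v, is_derive (fun z => F z v) u (dF u v)) -> continuous2 dF ->
  (forall u, continuous1 (F u)) ->
  is_derive (fun u => RInt (fun v => F u v) a b) u (RInt (fun v => dF u v) a b).
Proof.
intros D C CF.
assert (E : forall u v, Derive (fun z => F z v) u = dF u v) by (intros; now apply is_derive_unique).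
replace (RInt (fun v => dF u v) a b) with (RInt (fun v => Derive (fun z => F z v) u) a b).
- apply is_derive_RInt_param.
  + apply filter_forall. intros x t _. eexists; apply D.
  + intros t _. apply continuity_2d_pt_ext with dF; [intros; now rewrite E|].
    apply continuity_2d_pt_filterlim. apply (C (u, t)).
  + apply filter_forall. intros y. apply ex_RInt_cont1, CF.
- apply RInt_ext. intros; apply E.
Qed.

Lemma is_derive_RInt_cont (f : R -> R) a b : continuous1 f ->
  is_derive (fun x => RInt f a x) b (f b).
Proof.
intros C. apply (is_derive_RInt f (fun x => RInt f a x) a b).
- apply filter_forall. intros x. apply (RInt_correct (V := R_CompleteNormedModule)), ex_RInt_cont1, C.
- apply C.
Qed.

Lemma RInt_FTC (f df : R -> R) a b :
  (forall x, is_derive f x (df x)) -> continuous1 df -> RInt df a b = f b - f a.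
Proof.
intros D C. apply is_RInt_unique. apply (is_RInt_derive f df); intros; auto.
Qed.

Lemma const_of_derive_0 (f : R -> R) a b : (forall x, is_derive f x 0) -> f a = f b.
Proof.
intros D. assert (H := RInt_FTC f (fun _ => 0) a b D). rewrite RInt_const in H.
unfold scal in H; simpl in H; unfold mult in H; simpl in H.
specialize (H ltac:(cts)). lra.
Qed.

Lemma is_derive_minus_R (f g : R -> R) (x a b : R) :
  is_derive f x a -> is_derive g x b -> is_derive (fun x => f x - g x) x (a - b).
Proof. intros; now apply (is_derive_minus (V := R_NormedModule) f g). Qed.

Lemma is_derive_plus_R (f g : R -> R) (x a b : R) :
  is_derive f x a -> is_derive g x b -> is_derive (fun x => f x + g x) x (a + b).
Proof. intros; now apply (is_derive_plus (V := R_NormedModule) f g). Qed.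

Lemma is_derive_mult_R (f g : R -> R) (x a b : R) :
  is_derive f x a -> is_derive g x b -> is_derive (fun x => f x * g x) x (a * g x + f x * b).
Proof.
intros; apply (is_derive_mult (K := R_AbsRing) f g); auto. intros; apply Rmult_comm.
Qed.

Lemma is_derive_comp_R (f g : R -> R) (x a b : R) :
  is_derive f (g x) a -> is_derive g x b -> is_derive (fun x => f (g x)) x (b * a).
Proof. intros; now apply (is_derive_comp (K := R_AbsRing) (V := R_NormedModule) f g). Qed.

Lemma is_derive_eq (f : R -> R) (x a b : R) : is_derive f x a -> a = b -> is_derive f x b.
Proof. now intros H <-. Qed.

(** As functions of the upper limit of the [y]-integral, both sides have the same derivative and
    vanish at [c]. *)
Lemma fubini (F : R -> R -> R) a b c d : continuous2 F ->
  RInt (fun x => RInt (fun y => F x y) c d) a b = RInt (fun y => RInt (fun x => F x y) a b) c d.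
Proof.
intros C.
set (l := fun T => RInt (fun x => RInt (fun y => F x y) c T) a b).
set (r := fun T => RInt (fun y => RInt (fun x => F x y) a b) c T).
change (l d = r d).
assert (E : l c - r c = l d - r d).
{ apply (const_of_derive_0 (fun T => l T - r T)). intros T.
  replace 0 with (RInt (fun x => F x T) a b - RInt (fun x => F x T) a b) by ring.
  apply is_derive_minus_R.
  - apply (leibniz (fun T x => RInt (fun y => F x y) c T) (fun T x => F x T)).
    + intros. apply (is_derive_RInt_cont (F v)). cts.
    + cts.
    + intros u. cts.
  - apply (is_derive_RInt_cont (fun y => RInt (fun x => F x y) a b)). cts. }
unfold l at 1, r at 1 in E. rewrite RInt_point in E.
rewrite (RInt_ext _ (fun _ => 0)) in E.
- rewrite RInt_const in E. unfold scal, zero in E; simpl in E; unfold mult in E; simpl in E. lra.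
- intros. now rewrite RInt_point.
Qed.

(** The first argument is a parameter (time), along which only continuity is
    required; functions on the plane are those constant in it. *)
Record is_C1 (F Fx Fy : R -> R -> R -> R) : Prop := {
  c1_x : forall t x y, is_derive (fun z => F t z y) x (Fx t x y);
  c1_y : forall t x y, is_derive (fun z => F t x z) y (Fy t x y);
  c1_c : continuous3 F;
  c1_cx : continuous3 Fx;
  c1_cy : continuous3 Fy }.

Lemma C1_plus F Fx Fy G Gx Gy : is_C1 F Fx Fy -> is_C1 G Gx Gy ->
  is_C1 (fun t x y => F t x y + G t x y) (fun t x y => Fx t x y + Gx t x y)
     (fun t x y => Fy t x y + Gy t x y).
Proof.
intros [A1 A2 A3 A4 A5] [B1 B2 B3 B4 B5]; split; try now cts.
- intros; now apply (is_derive_plus_R (fun z => F t z y) (fun z => G t z y)).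
- intros; now apply (is_derive_plus_R (fun z => F t x z) (fun z => G t x z)).
Qed.

Lemma C1_minus F Fx Fy G Gx Gy : is_C1 F Fx Fy -> is_C1 G Gx Gy ->
  is_C1 (fun t x y => F t x y - G t x y) (fun t x y => Fx t x y - Gx t x y)
     (fun t x y => Fy t x y - Gy t x y).
Proof.
intros [A1 A2 A3 A4 A5] [B1 B2 B3 B4 B5]; split; try now cts.
- intros; now apply (is_derive_minus_R (fun z => F t z y) (fun z => G t z y)).
- intros; now apply (is_derive_minus_R (fun z => F t x z) (fun z => G t x z)).
Qed.

Lemma C1_mult F Fx Fy G Gx Gy : is_C1 F Fx Fy -> is_C1 G Gx Gy ->
  is_C1 (fun t x y => F t x y * G t x y)
     (fun t x y => Fx t x y * G t x y + F t x y * Gx t x y)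
     (fun t x y => Fy t x y * G t x y + F t x y * Gy t x y).
Proof.
intros [A1 A2 A3 A4 A5] [B1 B2 B3 B4 B5]; split; try now cts.
- intros; now apply (is_derive_mult_R (fun z => F t z y) (fun z => G t z y)).
- intros; now apply (is_derive_mult_R (fun z => F t x z) (fun z => G t x z)).
Qed.

Lemma C1_const c : is_C1 (fun _ _ _ => c) (fun _ _ _ => 0) (fun _ _ _ => 0).
Proof. split; try cts; intros; apply (is_derive_const (V := R_NormedModule)). Qed.

Lemma C1_X : is_C1 (fun _ x _ => x) (fun _ _ _ => 1) (fun _ _ _ => 0).
Proof.
split; try cts; intros.
- apply (is_derive_id (K := R_AbsRing)).
- apply (is_derive_const (V := R_NormedModule)).
Qed.

Lemma C1_Y : is_C1 (fun _ _ y => y) (fun _ _ _ => 0) (fun _ _ _ => 1).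
Proof.
split; try cts; intros.
- apply (is_derive_const (V := R_NormedModule)).
- apply (is_derive_id (K := R_AbsRing)).
Qed.

Lemma C1_comp K Kx Ky u ux uy v vx vy : is_C1 K Kx Ky -> is_C1 u ux uy -> is_C1 v vx vy ->
  is_C1 (fun t x y => K t (u t x y) (v t x y))
     (fun t x y => Kx t (u t x y) (v t x y) * ux t x y + Ky t (u t x y) (v t x y) * vx t x y)
     (fun t x y => Kx t (u t x y) (v t x y) * uy t x y + Ky t (u t x y) (v t x y) * vy t x y).
Proof.
intros [A1 A2 A3 A4 A5] [B1 B2 B3 B4 B5] [D1 D2 D3 D4 D5]; split; try now cts.
- intros; apply (chain2 (K t) (Kx t) (Ky t) (fun z => u t z y) (fun z => v t z y)); auto. cts.
- intros; apply (chain2 (K t) (Kx t) (Ky t) (fun z => u t x z) (fun z => v t x z)); auto. cts.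
Qed.

Lemma C1_at F Fx Fy t0 : is_C1 F Fx Fy -> is_C1 (fun _ => F t0) (fun _ => Fx t0) (fun _ => Fy t0).
Proof. intros [A1 A2 A3 A4 A5]; split; try (now cts); auto. Qed.

Lemma C1_RInt F Fx Fy a b : is_C1 F Fx Fy ->
  is_C1 (fun _ x y => RInt (fun t => F t x y) a b) (fun _ x y => RInt (fun t => Fx t x y) a b)
     (fun _ x y => RInt (fun t => Fy t x y) a b).
Proof.
intros [A1 A2 A3 A4 A5]; split; try now cts.
- intros; apply (leibniz (fun x t => F t x y) (fun x t => Fx t x y)); auto; intros; cts.
- intros; apply (leibniz (fun y t => F t x y) (fun y t => Fy t x y)); auto; intros; cts.
Qed.

(** * Green's formula and area-preserving maps of the disk *)


(* [ring] and [lra] read the carrier off the type of [RInt], which is not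
   syntactically [R]. *)
Ltac abstract_RInt :=
  repeat match goal with
  | |- context [@RInt ?V ?f ?a ?b] =>
    let r := fresh "r" in
    set (r := @RInt V f a b) in *; change R in (type of r); clearbody r
  end;
  try lazymatch goal with |- @eq _ ?a ?b => change (@eq R a b) end.
Ltac Rring := abstract_RInt; ring.

Lemma RInt_plus_c (f g : R -> R) a b : continuous1 f -> continuous1 g ->
  RInt (fun x => f x + g x) a b = RInt f a b + RInt g a b.
Proof. intros; apply (RInt_plus (V := R_CompleteNormedModule) f g); now apply ex_RInt_cont1. Qed.

Lemma RInt_minus_c (f g : R -> R) a b : continuous1 f -> continuous1 g ->
  RInt (fun x => f x - g x) a b = RInt f a b - RInt g a b.
Proof. intros; apply (RInt_minus (V := R_CompleteNormedModule) f g); now apply ex_RInt_cont1. Qed.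

Lemma RInt_scal_c (c : R) (f : R -> R) a b : continuous1 f ->
  RInt (fun x => c * f x) a b = c * RInt f a b.
Proof. intros; apply (RInt_scal (V := R_CompleteNormedModule) f); now apply ex_RInt_cont1. Qed.

Lemma RInt_Chasles_c (f : R -> R) a b c : continuous1 f -> RInt f a b + RInt f b c = RInt f a c.
Proof. intros; apply (RInt_Chasles (V := R_CompleteNormedModule) f); now apply ex_RInt_cont1. Qed.

Lemma RInt_swap_c (f : R -> R) a b : continuous1 f -> RInt f b a = - RInt f a b.
Proof.
intros H. generalize (RInt_Chasles_c f a b a H). rewrite RInt_point.
unfold zero; simpl; lra.
Qed.

Lemma RInt_affine (f : R -> R) u v a b : continuous1 f ->
  RInt f (u * a + v) (u * b + v) = RInt (fun y => u * f (u * y + v)) a b.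
Proof.
intros H; symmetry.
apply (RInt_comp_lin (V := R_CompleteNormedModule) f u v); now apply ex_RInt_cont1.
Qed.

Lemma RInt_ext_R (f g : R -> R) a b :
  (forall x, Rmin a b < x < Rmax a b -> f x = g x) -> RInt f a b = RInt g a b.
Proof. apply (RInt_ext (V := R_CompleteNormedModule)). Qed.

Lemma RInt_const_R (c : R) a b : RInt (fun _ => c) a b = (b - a) * c.
Proof. apply (RInt_const (V := R_CompleteNormedModule)). Qed.

(** The derivative in [a] of the left side is f(a + 2 pi) - f(a) = 0. *)
Lemma RInt_periodic (f : R -> R) a b : continuous1 f -> (forall x, f (x + 2 * PI) = f x) ->
  RInt f a (a + 2 * PI) = RInt f b (b + 2 * PI).
Proof.
intros C Hp.
assert (E : forall a, RInt f a (a + 2 * PI) = RInt f 0 (a + 2 * PI) - RInt f 0 a).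
{ intros x. rewrite <- (RInt_Chasles_c f 0 x (x + 2 * PI) C). Rring. }
rewrite !E.
apply (const_of_derive_0 (fun a => RInt f 0 (a + 2 * PI) - RInt f 0 a)).
intros x. apply is_derive_eq with (1 * f (x + 2 * PI) - f x); [|rewrite Hp; ring].
apply is_derive_minus_R.
- apply (is_derive_comp_R (fun b => RInt f 0 b) (fun a => a + 2 * PI)).
  + now apply is_derive_RInt_cont.
  + auto_derive; auto.
- now apply is_derive_RInt_cont.
Qed.

(** [disk_int] in the coordinates x = sin a, y = v cos a, which map the
    rectangle [-PI/2, PI/2] x [-1, 1] onto the disk with Jacobian cos^2 a. *)
Definition disk_int_rect (h : R -> R -> R) : R :=
  RInt (fun a => RInt (fun v => h (sin a) (v * cos a) * (cos a * cos a)) (-1) 1)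
    (- (PI / 2)) (PI / 2).

Lemma disk_int_ext (h k : R -> R -> R) :
  (forall x y, x ^ 2 + y ^ 2 < 1 -> h x y = k x y) -> disk_int h = disk_int k.
Proof.
intros E. apply RInt_ext_R. intros x Hx. rewrite Rmin_left, Rmax_right in Hx by lra.
apply RInt_ext_R. intros y Hy.
assert (S := sqrt_pos (1 - x ^ 2)). rewrite Rmin_left, Rmax_right in Hy by lra.
apply E. assert (Q := sqrt_sqrt (1 - x ^ 2)).
assert (0 <= 1 - x ^ 2) by nra. specialize (Q H). nra.
Qed.

(** Scaling [y] by the half-chord fixes the inner limits, and x = sin a replaces the square root,
    not differentiable at the ends, by cos a. The result has constant limits and no square root, so
    the lemmas on parametric integrals apply to it. *)
Lemma disk_int_rectE (h : R -> R -> R) : continuous2 h -> disk_int h = disk_int_rect h.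
Proof.
intros C. assert (HPI := PI_RGT_0).
set (s := fun x => sqrt (1 - x * x)).
assert (Cs : continuous1 s).
{ intros x. apply (continuous_comp (fun x => 1 - x * x) sqrt); [cts|apply continuous_sqrt]. }
set (k := fun x => s x * RInt (fun v => h x (s x * v)) (-1) 1).
assert (Ck : continuous1 k) by (unfold k; cts).
transitivity (RInt k (-1) 1).
- apply RInt_ext_R. intros x _.
  replace (1 - x ^ 2) with (1 - x * x) by ring.
  change (RInt (h x) (- s x) (s x) = k x).
  assert (Cx : continuous1 (h x)) by cts.
  assert (E := RInt_affine (h x) (s x) 0 (-1) 1 Cx).
  replace (s x * -1 + 0) with (- s x) in E by ring.
  replace (s x * 1 + 0) with (s x) in E by ring. rewrite E.
  unfold k. rewrite <- RInt_scal_c by cts.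
  apply RInt_ext_R. intros v _. now replace (s x * v + 0) with (s x * v) by ring.
- assert (E := RInt_comp (V := R_CompleteNormedModule) k sin cos (- (PI / 2)) (PI / 2)).
  rewrite sin_neg, sin_PI2 in E. change (- (1)) with (-1) in E.
  rewrite <- E.
  + apply RInt_ext_R. intros a Ha. rewrite Rmin_left, Rmax_right in Ha by lra.
    assert (Hc : 0 <= cos a) by (apply cos_ge_0; lra).
    assert (Es : s (sin a) = cos a).
    { unfold s. replace (1 - sin a * sin a) with (cos a * cos a).
      - now apply sqrt_square.
      - generalize (sin2_cos2 a). unfold Rsqr. lra. }
    change (cos a * k (sin a) =
       RInt (fun v => h (sin a) (v * cos a) * (cos a * cos a)) (-1) 1).
    unfold k. rewrite Es.
    rewrite <- Rmult_assoc, <- RInt_scal_c by cts.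
    apply RInt_ext_R. intros v _. rewrite (Rmult_comm v). ring.
  + intros; apply Ck.
  + intros x _; split; [apply is_derive_sin | apply continuous1_cos].
Qed.

Lemma rect_point_in_disk a v : -1 <= v <= 1 -> in_disk (sin a, v * cos a).
Proof.
intros Hv. unfold in_disk; simpl. generalize (sin2_cos2 a); unfold Rsqr; intros E.
assert (0 <= (1 - v * v) * (cos a * cos a)).
{ apply Rmult_le_pos; nra. }
nra.
Qed.

Lemma disk_int_rect_ext (h k : R -> R -> R) :
  (forall x y, in_disk (x, y) -> h x y = k x y) -> disk_int_rect h = disk_int_rect k.
Proof.
intros E. apply RInt_ext_R. intros a _. apply RInt_ext_R.
intros v Hv. rewrite Rmin_left, Rmax_right in Hv by lra.
rewrite E; auto. apply rect_point_in_disk; lra.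
Qed.

Lemma disk_int_rect_plus h k : continuous2 h -> continuous2 k ->
  disk_int_rect (fun x y => h x y + k x y) = disk_int_rect h + disk_int_rect k.
Proof.
intros Ch Ck. unfold disk_int_rect. rewrite <- RInt_plus_c by cts.
apply RInt_ext_R. intros a _. rewrite <- RInt_plus_c by cts.
apply RInt_ext_R. intros; ring.
Qed.

Lemma disk_int_rect_minus h k : continuous2 h -> continuous2 k ->
  disk_int_rect (fun x y => h x y - k x y) = disk_int_rect h - disk_int_rect k.
Proof.
intros Ch Ck. unfold disk_int_rect. rewrite <- RInt_minus_c by cts.
apply RInt_ext_R. intros a _. rewrite <- RInt_minus_c by cts.
apply RInt_ext_R. intros; ring.
Qed.

Lemma disk_int_rect_RInt (F : R -> R -> R -> R) a b : continuous3 F ->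
  disk_int_rect (fun x y => RInt (fun t => F t x y) a b)
    = RInt (fun t => disk_int_rect (F t)) a b.
Proof.
intros C. unfold disk_int_rect.
rewrite <- (fubini (fun x t => RInt (fun v => F t (sin x) (v * cos x) * (cos x * cos x)) (-1) 1))
  by cts.
apply RInt_ext_R. intros x _.
rewrite (fubini (fun t v => F t (sin x) (v * cos x) * (cos x * cos x))) by cts.
apply RInt_ext_R. intros v _.
rewrite Rmult_comm, <- RInt_scal_c by cts. apply RInt_ext_R. intros; ring.
Qed.

(** * Green's formula on the disk *)

Definition circle_int (P Q : R -> R -> R) : R :=
  RInt (fun th => Q (cos th) (sin th) * cos th - P (cos th) (sin th) * sin th) (- PI) PI.

(** The form is pulled back to the rectangle, where Green's formula is the fundamental theorem of
    calculus in each variable. The sides a = -pi/2 and a = pi/2 collapse to points of the disk and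
    contribute nothing; the sides v = 1 and v = -1 are the upper and lower half circles. *)
Lemma green P Px Py Q Qx Qy t : is_C1 P Px Py -> is_C1 Q Qx Qy ->
  disk_int_rect (fun x y => Qx t x y - Py t x y) = circle_int (P t) (Q t).
Proof.
intros [P1 P2 P3 P4 P5] [Q1 Q2 Q3 Q4 Q5].
(* With x = sin a and y = v cos a, the pullback of P dx + Q dy is A da + B dv. Terms in Qy and Q
   cancel in dB/da - dA/dv, leaving (Qx - Py) cos^2 a. *)
set (B := fun a v => Q t (sin a) (v * cos a) * cos a).
set (dB := fun a v => (Qx t (sin a) (v * cos a) * cos a + Qy t (sin a) (v * cos a) * (v * - sin a))
   * cos a + Q t (sin a) (v * cos a) * - sin a).
set (A := fun a v => P t (sin a) (v * cos a) * cos a - Q t (sin a) (v * cos a) * (v * sin a)).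
set (dA := fun a v => Py t (sin a) (v * cos a) * cos a * cos a -
   (Qy t (sin a) (v * cos a) * cos a * (v * sin a) + Q t (sin a) (v * cos a) * sin a)).
assert (DB : forall a v, is_derive (fun a => B a v) a (dB a v)).
{ intros a v. unfold B, dB. apply (is_derive_mult_R (fun a => Q t (sin a) (v * cos a)) cos); [|apply is_derive_cos].
  apply (chain2 (Q t) (Qx t) (Qy t) sin (fun a => v * cos a)); auto.
  - cts.
  - apply is_derive_sin.
  - apply (is_derive_scal (fun a => cos a)). apply is_derive_cos. }
assert (Dl : forall c v, is_derive (fun v => v * c) v c).
{ intros; auto_derive; auto; ring. }
assert (Dc : forall K Kx Ky, is_C1 K Kx Ky -> forall a v,
  is_derive (fun v => K t (sin a) (v * cos a)) v (Ky t (sin a) (v * cos a) * cos a)).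
{ intros K Kx Ky HK a v. rewrite Rmult_comm.
  apply (is_derive_comp_R (K t (sin a)) (fun v => v * cos a)).
  - apply HK.
  - apply Dl. }
assert (DA : forall a v, is_derive (A a) v (dA a v)).
{ intros a v. unfold A, dA.
  apply (is_derive_minus_R (fun v => P t (sin a) (v * cos a) * cos a)
    (fun v => Q t (sin a) (v * cos a) * (v * sin a))).
  - replace (Py t (sin a) (v * cos a) * cos a * cos a) with
      (Py t (sin a) (v * cos a) * cos a * cos a + P t (sin a) (v * cos a) * 0) by ring.
    apply (is_derive_mult_R (fun v => P t (sin a) (v * cos a)) (fun _ => cos a)).
    + now apply (Dc P Px Py).
    + apply (is_derive_const (V := R_NormedModule)).
  - apply (is_derive_mult_R (fun v => Q t (sin a) (v * cos a)) (fun v => v * sin a)).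
    + now apply (Dc Q Qx Qy).
    + apply Dl. }
assert (E1 : RInt (fun a => RInt (fun v => dB a v) (-1) 1) (- (PI / 2)) (PI / 2) = 0).
{ rewrite (RInt_FTC (fun a => RInt (B a) (-1) 1)).
  - rewrite (RInt_ext_R (B (PI / 2)) (fun _ => 0)), (RInt_ext_R (B (- (PI / 2))) (fun _ => 0)).
    + Rring.
    + intros. unfold B. rewrite cos_neg, cos_PI2. ring.
    + intros. unfold B. rewrite cos_PI2. ring.
  - intros a. apply (leibniz B dB); auto; unfold B, dB; cts.
  - unfold dB; cts. }
set (u := fun th => Q t (cos th) (sin th) * cos th - P t (cos th) (sin th) * sin th).
assert (Cu : continuous1 u) by (unfold u; cts).
(* The point (sin a, cos a) has angle pi/2 - a, and (sin a, - cos a) has angle a - pi/2. *)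
assert (E2 : forall a, RInt (dA a) (-1) 1 = - u (-1 * a + PI / 2) - u (1 * a + - (PI / 2))).
{ intros a. rewrite (RInt_FTC (A a)); [|intros; apply DA|unfold dA; cts].
  unfold A, u. replace (-1 * a + PI / 2) with (PI / 2 - a) by ring.
  replace (1 * a + - (PI / 2)) with (- (PI / 2 - a)) by ring.
  rewrite cos_neg, sin_neg, cos_shift, sin_shift.
  rewrite Rmult_1_l. replace (-1 * cos a) with (- cos a) by ring. Rring. }
transitivity (RInt (fun a => RInt (fun v => dB a v) (-1) 1 - RInt (dA a) (-1) 1)
   (- (PI / 2)) (PI / 2)).
- apply RInt_ext_R. intros a _. rewrite <- RInt_minus_c.
  + apply RInt_ext_R. intros v _. unfold dB, dA. ring.
  + unfold dB; cts.
  + unfold dA; cts.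
- rewrite RInt_minus_c by (unfold dB, dA; cts). rewrite E1.
  rewrite (RInt_ext_R (fun a => RInt (dA a) (-1) 1)
    (fun a => -1 * u (-1 * a + PI / 2) - 1 * u (1 * a + - (PI / 2)))).
  2: { intros. rewrite E2. ring. }
  rewrite RInt_minus_c by cts.
  rewrite <- !RInt_affine by auto.
  replace (-1 * - (PI / 2) + PI / 2) with PI by field.
  replace (-1 * (PI / 2) + PI / 2) with 0 by field.
  replace (1 * - (PI / 2) + - (PI / 2)) with (- PI) by field.
  replace (1 * (PI / 2) + - (PI / 2)) with 0 by field.
  unfold circle_int. fold u.
  rewrite <- (RInt_Chasles_c u (- PI) 0 PI Cu), (RInt_swap_c u 0 PI Cu). ring.
Qed.

(** * Antiderivatives and change of variables *)

(** Moves a variable upper limit into the integrand, so that continuity in that limit becomes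
    continuity of an integral with fixed limits. *)
Lemma RInt_0_scale (f : R -> R) x : continuous1 f -> RInt f 0 x = x * RInt (fun r => f (x * r)) 0 1.
Proof.
intros C. rewrite <- RInt_scal_c by cts.
replace (RInt f 0 x) with (RInt f (x * 0 + 0) (x * 1 + 0)) by (f_equal; ring).
rewrite RInt_affine by auto. apply RInt_ext_R. intros. now rewrite Rplus_0_r.
Qed.

Lemma cont_RInt_var (psi : R -> R -> R -> R) : continuous3 psi ->
  continuous3 (fun t x y => RInt (fun s => psi t s y) 0 x).
Proof.
intros C p.
apply continuous_ext with (fun p : R * R * R =>
  snd (fst p) * RInt (fun r => psi (fst (fst p)) (snd (fst p) * r) (snd p)) 0 1).
- intros q. rewrite <- (RInt_0_scale (fun s => psi (fst (fst q)) s (snd q))); auto. cts.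
- cts.
Qed.

Lemma C1_antiderivative psi psix psiy : is_C1 psi psix psiy ->
  is_C1 (fun t x y => RInt (fun s => psi t s y) 0 x) psi
     (fun t x y => RInt (fun s => psiy t s y) 0 x).
Proof.
intros [A1 A2 A3 A4 A5]; split; auto.
- intros. apply (is_derive_RInt_cont (fun s => psi t s y)). cts.
- intros. apply (leibniz (fun y s => psi t s y) (fun y s => psiy t s y)); auto; intros; cts.
- now apply cont_RInt_var.
- now apply cont_RInt_var.
Qed.

Lemma circle_derive F Fx Fy t th : is_C1 F Fx Fy ->
  is_derive (fun th => F t (cos th) (sin th)) th
    (Fy t (cos th) (sin th) * cos th - Fx t (cos th) (sin th) * sin th).
Proof.
intros [A1 A2 A3 A4 A5].
replace (Fy t (cos th) (sin th) * cos th - Fx t (cos th) (sin th) * sin th) with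
 (Fx t (cos th) (sin th) * - sin th + Fy t (cos th) (sin th) * cos th) by ring.
apply (chain2 (F t) (Fx t) (Fy t) cos sin); auto.
- cts.
- apply is_derive_cos.
- apply is_derive_sin.
Qed.

(** With A an x-antiderivative of psi, the pullback of psi dx /\ dy is the
    differential of A(h) dh2; by Green both sides reduce to integrals of A dy
    along the circle, on which h acts as a map of degree one. *)
Lemma change_of_variables psi psix psiy h1 h1x h1y h2 h2x h2y h2xx h2xy h2yx h2yy t
  (F dF : R -> R) :
  is_C1 psi psix psiy -> is_C1 h1 h1x h1y -> is_C1 h2 h2x h2y -> is_C1 h2x h2xx h2xy -> is_C1 h2y h2yx h2yy ->
  (forall x y, h2xy t x y = h2yx t x y) ->
  (forall x y, in_disk (x, y) -> h1x t x y * h2y t x y - h1y t x y * h2x t x y = 1) ->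
  (forall th, h1 t (cos th) (sin th) = cos (F th)) ->
  (forall th, h2 t (cos th) (sin th) = sin (F th)) ->
  (forall th, is_derive F th (dF th)) -> continuous1 dF -> F PI = F (- PI) + 2 * PI ->
  disk_int_rect (fun x y => psi t (h1 t x y) (h2 t x y)) = disk_int_rect (psi t).
Proof.
intros Hpsi H1 H2 H2x H2y Hsym Hjac Hc Hs DF CdF Hdeg.
assert (HA := C1_antiderivative _ _ _ Hpsi).
set (A := fun t x y => RInt (fun s => psi t s y) 0 x) in HA.
set (Ay := fun t x y => RInt (fun s => psiy t s y) 0 x) in HA.
assert (HAh := C1_comp _ _ _ _ _ _ _ _ _ HA H1 H2).
assert (G1 := green _ _ _ _ _ _ t (C1_mult _ _ _ _ _ _ HAh H2x) (C1_mult _ _ _ _ _ _ HAh H2y)).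
assert (G2 := green _ _ _ _ _ _ t (C1_const 0) HA).
cbv beta in G1, G2.
transitivity (circle_int (fun x y => A t (h1 t x y) (h2 t x y) * h2x t x y)
  (fun x y => A t (h1 t x y) (h2 t x y) * h2y t x y)).
- rewrite <- G1. apply disk_int_rect_ext. intros x y Hxy.
  (* The second derivatives of [h2] cancel by symmetry and the terms in the [y]-derivative of [A]
     cancel by themselves; psi(h) times the Jacobian remains. *)
  rewrite Hsym. transitivity (psi t (h1 t x y) (h2 t x y) * 1); [ring|].
  rewrite <- (Hjac x y Hxy). ring.
- transitivity (circle_int (fun _ _ => 0) (A t)).
  2: { rewrite <- G2. apply disk_int_rect_ext. intros; ring. }
  unfold circle_int.
  set (f := fun s => A t (cos s) (sin s) * cos s - 0 * sin s).
  assert (CA : continuous3 A) by apply HA.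
  assert (Cf : continuous1 f) by (unfold f; cts).
  transitivity (RInt f (F (- PI)) (F PI)).
  + rewrite <- (RInt_comp (V := R_CompleteNormedModule) f F dF).
    * apply RInt_ext_R. intros th _. rewrite Hc, Hs.
      change (scal (dF th) (f (F th))) with (dF th * f (F th)).
      (* The function h2(cos th, sin th) = sin(F th) is differentiated in two ways, which identifies
         the restriction of dh2 to the circle with cos(F) dF. *)
      assert (U1 := circle_derive _ _ _ t th H2).
      assert (U2 : is_derive (fun th => h2 t (cos th) (sin th)) th (dF th * cos (F th))).
      { apply (is_derive_ext (fun th => sin (F th))); [intros; now rewrite Hs|].
        apply (is_derive_comp_R sin F); auto.
        apply is_derive_sin. }
      apply is_derive_unique in U1. apply is_derive_unique in U2. rewrite U1 in U2.
      unfold f. transitivity (A t (cos (F th)) (sin (F th)) *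
        (h2y t (cos th) (sin th) * cos th - h2x t (cos th) (sin th) * sin th)); [ring|].
      rewrite U2. ring.
    * intros; apply Cf.
    * intros; split; auto.
  + rewrite Hdeg. transitivity (RInt f (- PI) (- PI + 2 * PI)).
    2: { apply (f_equal (RInt f (- PI))). ring. }
    apply RInt_periodic; auto.
    intros x. unfold f.
    rewrite cos_plus, sin_plus, cos_2PI, sin_2PI.
    now rewrite !Rmult_1_r, !Rmult_0_r, Rminus_0_r, Rplus_0_r.
Qed.

(** * Translation numbers of degree-one maps *)


Lemma circle_angle x y : x * x + y * y = 1 -> exists th, x = cos th /\ y = sin th.
Proof.
intros E. assert (Hx : -1 <= x <= 1) by nra.
assert (S : sin (acos x) = sqrt (1 - x²)) by (apply sin_acos; lra).
assert (K : 1 - x² = y * y) by (unfold Rsqr; lra).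
destruct (Rle_or_lt 0 y).
- exists (acos x). rewrite cos_acos, S, K by lra. split; auto. now rewrite sqrt_square.
- exists (- acos x). rewrite cos_neg, sin_neg, cos_acos, S, K by lra. split; auto.
  replace (y * y) with (- y * - y) by ring. rewrite sqrt_square; lra.
Qed.

Lemma cos_eq_1 x : cos x = 1 -> exists k : Z, x = 2 * PI * IZR k.
Proof.
intros H. assert (S : sin (x / 2) = 0).
{ replace x with (2 * (x / 2)) in H by field. rewrite cos_2a_sin in H. nra. }
destruct (sin_eq_0_0 _ S) as [k Hk]. exists k. lra.
Qed.

Lemma same_angle a b : cos a = cos b -> sin a = sin b -> exists k : Z, a = b + 2 * PI * IZR k.
Proof.
intros Hc Hs. destruct (cos_eq_1 (a - b)) as [k Hk].
- rewrite cos_minus, Hc, Hs. generalize (sin2_cos2 b). unfold Rsqr. lra.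
- exists k. lra.
Qed.

Lemma sin_cos_period x (k : Z) :
  cos (x + 2 * PI * IZR k) = cos x /\ sin (x + 2 * PI * IZR k) = sin x.
Proof.
assert (N : forall n x, cos (x + 2 * PI * INR n) = cos x /\ sin (x + 2 * PI * INR n) = sin x).
{ intros n z. replace (z + 2 * PI * INR n) with (z + 2 * INR n * PI) by ring.
  now rewrite cos_period, sin_period. }
destruct (Z_le_gt_dec 0 k) as [H|H].
- rewrite <- (Z2Nat.id k H), <- INR_IZR_INZ. apply N.
- destruct (N (Z.to_nat (- k)) (x + 2 * PI * IZR k)) as [N1 N2].
  rewrite INR_IZR_INZ, Z2Nat.id, opp_IZR in N1, N2 by lia.
  replace (x + 2 * PI * IZR k + 2 * PI * - IZR k) with x in N1, N2 by ring. now split.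
Qed.

Lemma continuous1_continuity F : continuous1 F -> continuity F.
Proof. intros C x. apply continuity_pt_filterlim. apply C. Qed.

(** The difference is continuous with values in 2 pi Z. If it increased between two points it would,
    by the intermediate value theorem, take a value that is pi more than a multiple of 2 pi. *)
Lemma lifts_differ (F G : R -> R) : continuous1 F -> continuous1 G ->
  (forall th, cos (F th) = cos (G th)) -> (forall th, sin (F th) = sin (G th)) ->
  exists k : Z, forall th, F th = G th + 2 * PI * IZR k.
Proof.
intros CF CG Hc Hs. assert (HPI := PI_RGT_0).
set (D := fun th => F th - G th).
assert (CD : continuity D) by (apply continuous1_continuity; unfold D; cts).
assert (HD : forall th, exists k : Z, D th = 2 * PI * IZR k).
{ intros th. destruct (same_angle _ _ (Hc th) (Hs th)) as [k Hk]. exists k. unfold D; lra. }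
assert (M : forall a b, D b <= D a).
{ intros a b. apply Rnot_lt_le. intros Hlt.
  destruct (HD a) as [i Hi]; destruct (HD b) as [j Hj].
  assert (Hij : (i + 1 <= j)%Z).
  { apply Zlt_le_succ, lt_IZR. nra. }
  apply IZR_le in Hij. rewrite plus_IZR in Hij.
  destruct (IVT_gen D a b (D a + PI) CD) as [c [_ Hcc]].
  { split; [apply Rle_trans with (D a); [apply Rmin_l|lra]|].
    apply Rle_trans with (D b); [|apply Rmax_r]. nra. }
  destruct (HD c) as [m Hm].
  assert (E : 2 * IZR m = 2 * IZR i + 1) by nra.
  rewrite <- !mult_IZR, <- plus_IZR in E. apply eq_IZR in E. lia. }
destruct (HD 0) as [k Hk]. exists k. intros th.
assert (D th = D 0) by (apply Rle_antisym; apply M). unfold D in *; lra.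
Qed.

Section DegreeOne.

Variable F : R -> R.
Hypothesis F_cont : continuous1 F.
Hypothesis F_deg : forall th, F (th + 2 * PI) = F th + 2 * PI.

Lemma degree_one_Z th (k : Z) : F (th + 2 * PI * IZR k) = F th + 2 * PI * IZR k.
Proof.
assert (N : forall n th, F (th + 2 * PI * INR n) = F th + 2 * PI * INR n).
{ induction n; intros.
  - simpl. now rewrite !Rmult_0_r, !Rplus_0_r.
  - rewrite S_INR. replace (th0 + 2 * PI * (INR n + 1)) with (th0 + 2 * PI * INR n + 2 * PI) by ring.
    rewrite F_deg, IHn. ring. }
destruct (Z_le_gt_dec 0 k) as [H|H].
- rewrite <- (Z2Nat.id k H), <- INR_IZR_INZ. apply N.
- assert (E := N (Z.to_nat (- k)) (th + 2 * PI * IZR k)).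
  rewrite INR_IZR_INZ, Z2Nat.id, opp_IZR in E by lia.
  replace (th + 2 * PI * IZR k + 2 * PI * - IZR k) with th in E by ring. lra.
Qed.

(** Suppose a < b and F(b) < F(a). Since F(a + 2 pi k) is large for k > 0, the value F(a) is taken
    again between b and some a + 2 pi k > b, contradicting injectivity. *)
Lemma degree_one_monotone : (forall a b, F a = F b -> a = b) ->
  forall a b, a <= b -> F a <= F b.
Proof.
intros Hinj a b Hab. apply Rnot_lt_le. intros Hlt. assert (HPI := PI_RGT_0).
assert (Hab' : a < b). { destruct Hab; auto. subst; lra. }
set (k := up ((b - a) / (2 * PI))).
destruct (archimed ((b - a) / (2 * PI))) as [Hk _]. fold k in Hk.
assert (Hb : b < a + 2 * PI * IZR k).
{ apply (Rmult_lt_compat_r (2 * PI)) in Hk; [|lra].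
  replace ((b - a) / (2 * PI) * (2 * PI)) with (b - a) in Hk by (field; lra). lra. }
destruct (IVT_gen F b (a + 2 * PI * IZR k) (F a)) as [c [Hc E]].
- now apply continuous1_continuity.
- rewrite degree_one_Z. split; [apply Rle_trans with (F b); [apply Rmin_l|lra]|].
  apply Rle_trans with (F a + 2 * PI * IZR k); [|apply Rmax_r].
  assert (0 < 2 * PI * IZR k) by lra. lra.
- rewrite Rmin_left in Hc by lra. apply Hinj in E. lra.
Qed.

Hypothesis F_mono : forall a b, a <= b -> F a <= F b.

Lemma iter_degree_one n th : Nat.iter n F (th + 2 * PI) = Nat.iter n F th + 2 * PI.
Proof. induction n; simpl; auto. now rewrite IHn, F_deg. Qed.

Lemma iter_mono n a b : a <= b -> Nat.iter n F a <= Nat.iter n F b.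
Proof. induction n; simpl; auto. Qed.
End DegreeOne.

Lemma iter_continuous1 F n : continuous1 F -> continuous1 (fun th => Nat.iter n F th).
Proof. intros C; induction n; simpl; cts. Qed.

(** Periodicity of the displacement reduces [th] to [0, 2 pi], where monotonicity traps the iterate
    between F^n(0) and F^n(0) + 2 pi. The bound does not depend on [n]. *)
Lemma iter_displacement F n th : (forall th, F (th + 2 * PI) = F th + 2 * PI) ->
  (forall a b, a <= b -> F a <= F b) ->
  Rabs (Nat.iter n F th - th - Nat.iter n F 0) <= 2 * PI.
Proof.
intros D M. assert (HPI := PI_RGT_0).
set (k := Int_part (th / (2 * PI))).
destruct (base_Int_part (th / (2 * PI))) as [K1 K2]. fold k in K1, K2.
set (r := th - 2 * PI * IZR k).
assert (E : th = 2 * PI * (th / (2 * PI))) by (field; lra).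
assert (Hr : 0 <= r <= 0 + 2 * PI) by (unfold r; nra).
assert (Et : th = r + 2 * PI * IZR k) by (unfold r; ring).
rewrite Et, (degree_one_Z (fun th => Nat.iter n F th)) by (intros; now apply iter_degree_one).
assert (A1 := iter_mono F M n 0 r (proj1 Hr)).
assert (A2 := iter_mono F M n r (0 + 2 * PI) (proj2 Hr)).
rewrite iter_degree_one in A2 by auto.
apply Rabs_le. lra.
Qed.

(** * Slopes of quasi-additive sequences *)

(** Each step of the induction costs [C]; the additional [C] pays for n = 0, where the quantity is
    |a 0|. *)
Lemma quasi_additive_mult (a : nat -> R) (C : R) (n m : nat) :
  (forall m n, Rabs (a (m + n)%nat - a m - a n) <= C) ->
  Rabs (a (n * m)%nat - INR n * a m) <= (INR n + 1) * C.
Proof.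
intros H. induction n.
- simpl. specialize (H 0%nat 0%nat). simpl in H.
  replace (a 0%nat - a 0%nat - a 0%nat) with (- a 0%nat) in H by ring. rewrite Rabs_Ropp in H.
  replace (a 0%nat - 0 * a m) with (a 0%nat) by ring. lra.
- rewrite S_INR. simpl. specialize (H m (n * m)%nat).
  replace (a (m + n * m)%nat - (INR n + 1) * a m) with
   ((a (m + n * m)%nat - a m - a (n * m)%nat) + (a (n * m)%nat - INR n * a m)) by ring.
  eapply Rle_trans; [apply Rabs_triang|]. lra.
Qed.

(** Both slopes are compared with the slope at the product n m. The resulting estimate makes the
    slopes a Cauchy sequence. *)
Lemma quasi_additive_slope (a : nat -> R) (C : R) (n m : nat) : (1 <= n)%nat -> (1 <= m)%nat ->
  (forall m n, Rabs (a (m + n)%nat - a m - a n) <= C) ->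
  Rabs (a n / INR n - a m / INR m) <= 2 * C / INR n + 2 * C / INR m.
Proof.
intros Hn Hm H.
assert (C0 : 0 <= C) by (eapply Rle_trans; [apply Rabs_pos|apply (H 0%nat 0%nat)]).
assert (A : forall n m, (1 <= n)%nat -> (1 <= m)%nat ->
  Rabs (a (n * m)%nat / (INR n * INR m) - a m / INR m) <= 2 * C / INR m).
{ clear n m Hn Hm. intros n m Hn Hm. apply le_INR in Hn, Hm. simpl in Hn, Hm.
  assert (K := quasi_additive_mult a C n m H).
  replace (a (n * m)%nat / (INR n * INR m) - a m / INR m) with
    ((a (n * m)%nat - INR n * a m) / (INR n * INR m)) by (field; lra).
  unfold Rdiv. rewrite Rabs_mult, (Rabs_right (/ _)).
  2: { apply Rle_ge, Rlt_le, Rinv_0_lt_compat. nra. }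
  apply (Rmult_le_reg_r (INR n * INR m)); [nra|].
  rewrite Rmult_assoc, Rinv_l by nra.
  replace (2 * C * / INR m * (INR n * INR m)) with (2 * C * INR n) by (field; lra). nra. }
assert (A1 := A n m Hn Hm). assert (A2 := A m n Hm Hn).
rewrite (Nat.mul_comm m n), (Rmult_comm (INR m)) in A2.
revert A1 A2. generalize (a (n * m)%nat / (INR n * INR m)). intros z A1 A2.
apply Rabs_le_between in A1, A2. apply Rabs_le_between. lra.
Qed.

Lemma is_lim_seq_inv_INR (c : R) : is_lim_seq (fun n => c / INR n) 0.
Proof.
apply (is_lim_seq_ext (fun n => c * / INR n)); [reflexivity|].
replace (Finite 0) with (Rbar_mult c 0) by (simpl; f_equal; ring).
apply is_lim_seq_scal_l.
replace (Finite 0) with (Rbar_inv p_infty) by reflexivity.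
apply is_lim_seq_inv; [apply is_lim_seq_INR|discriminate].
Qed.

Lemma quasi_additive_converges (a : nat -> R) (C : R) :
  (forall m n, Rabs (a (m + n)%nat - a m - a n) <= C) ->
  exists L : R, is_lim_seq (fun n => a n / INR n) L.
Proof.
intros H. apply ex_lim_seq_cauchy_corr. intros eps.
destruct (is_lim_seq_inv_INR (2 * C) (ball 0 (pos_div_2 eps))) as [N HN].
{ exists (pos_div_2 eps); auto. }
exists (S N). intros n m Hn Hm.
assert (K1 := HN n ltac:(lia)). assert (K2 := HN m ltac:(lia)).
apply Rabs_def2 in K1, K2. unfold minus, plus, opp in K1, K2; simpl in K1, K2.
eapply Rle_lt_trans; [apply (quasi_additive_slope a C); auto; lia|]. lra.
Qed.

(** Meant for [b n] the value of tau on the n-th iterate, [a n] the orbit of 0 under the lift, e =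
    pi/2 and [c] the integral of phi. *)
Lemma lim_seq_bounded_error (b a : nat -> R) (C L c e : R) :
  is_lim_seq (fun n => a n / INR n) L ->
  (forall n, Rabs (b n - (e * a n - INR n * c)) <= C) ->
  is_lim_seq (fun n => b n / INR n) (e * L - c).
Proof.
intros HL HC.
apply (is_lim_seq_ext_loc (fun n => (e * (a n / INR n) - c) + (b n - (e * a n - INR n * c)) / INR n)).
{ exists 1%nat. intros n Hn. apply le_INR in Hn; simpl in Hn. field. lra. }
replace (e * L - c) with ((e * L - c) + 0) by ring.
apply is_lim_seq_plus'.
- apply is_lim_seq_minus'; [|apply is_lim_seq_const].
  apply (is_lim_seq_scal_l _ e L HL).
- apply is_lim_seq_abs_0.
  apply (is_lim_seq_le_le_loc (fun _ => 0) _ (fun n => C / INR n)).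
  + exists 1%nat. intros n Hn. apply le_INR in Hn; simpl in Hn. split; [apply Rabs_pos|].
    unfold Rdiv. rewrite Rabs_mult, (Rabs_right (/ _)).
    * apply Rmult_le_compat_r; auto. apply Rlt_le, Rinv_0_lt_compat; lra.
    * apply Rle_ge, Rlt_le, Rinv_0_lt_compat; lra.
  + apply is_lim_seq_const.
  + apply is_lim_seq_inv_INR.
Qed.

Lemma iter_slope_converges F : (forall th, F (th + 2 * PI) = F th + 2 * PI) ->
  (forall a b, a <= b -> F a <= F b) ->
  exists L : R, is_lim_seq (fun n => Nat.iter n F 0 / INR n) L.
Proof.
intros D M. apply (quasi_additive_converges (fun n => Nat.iter n F 0) (2 * PI)).
intros m n. rewrite Nat.iter_add.
replace (Nat.iter m F (Nat.iter n F 0) - Nat.iter m F 0 - Nat.iter n F 0) with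
  (Nat.iter m F (Nat.iter n F 0) - Nat.iter n F 0 - Nat.iter m F 0) by ring.
now apply iter_displacement.
Qed.

Lemma transl_of_slope F (L : R) : is_lim_seq (fun n => Nat.iter n F 0 / INR n) L ->
  transl F = L / (2 * PI).
Proof.
intros H. unfold transl. assert (HPI := PI_RGT_0).
assert (E : is_lim_seq (fun n => Nat.iter n F 0 / (2 * PI * INR n)) (/ (2 * PI) * L)).
{ apply (is_lim_seq_ext_loc (fun n => / (2 * PI) * (Nat.iter n F 0 / INR n))).
  - exists 1%nat. intros n Hn. apply le_INR in Hn; simpl in Hn. field. lra.
  - apply (is_lim_seq_scal_l _ (/ (2 * PI)) L H). }
rewrite (is_lim_seq_unique _ _ E). simpl. field. lra.
Qed.

Lemma iter_translate F G (k : Z) n : (forall th, G (th + 2 * PI) = G th + 2 * PI) ->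
  (forall th, F th = G th + 2 * PI * IZR k) ->
  Nat.iter n F 0 = Nat.iter n G 0 + 2 * PI * IZR k * INR n.
Proof.
intros D E. induction n.
- simpl. ring.
- rewrite S_INR. simpl. rewrite IHn, E.
  replace (2 * PI * IZR k * INR n) with (2 * PI * IZR (k * Z.of_nat n)).
  + rewrite degree_one_Z by auto. rewrite mult_IZR, <- INR_IZR_INZ. ring.
  + rewrite mult_IZR, <- INR_IZR_INZ. ring.
Qed.

Lemma transl_translate F G (k : Z) (L : R) : (forall th, G (th + 2 * PI) = G th + 2 * PI) ->
  (forall th, F th = G th + 2 * PI * IZR k) ->
  is_lim_seq (fun n => Nat.iter n G 0 / INR n) L -> transl F = transl G + IZR k.
Proof.
intros D E H. assert (HPI := PI_RGT_0).
rewrite (transl_of_slope G L H), (transl_of_slope F (L + 2 * PI * IZR k)).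
- field. lra.
- apply (is_lim_seq_ext_loc (fun n => Nat.iter n G 0 / INR n + 2 * PI * IZR k)).
  + exists 1%nat. intros n Hn. apply le_INR in Hn; simpl in Hn.
    rewrite (iter_translate F G k n D E). field. lra.
  + apply is_lim_seq_plus'; auto. apply is_lim_seq_const.
Qed.

(** * Smooth functions on the disk *)


Lemma iter_pder_app l d F : iter_pder l (pder d F) = iter_pder (l ++ d :: nil) F.
Proof. induction l; simpl; auto. now rewrite IHl. Qed.

Lemma smooth3_pder F d : smooth3 F -> smooth3 (pder d F).
Proof.
intros H l t x y. specialize (H (l ++ d :: nil) t x y). now rewrite iter_pder_app.
Qed.

Lemma smooth3_continuous F : smooth3 F -> continuous3 F.
Proof. intros H [[t x] y]. apply (proj2 (H nil t x y)). Qed.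

Lemma smooth3_C1 F : smooth3 F -> is_C1 F (pder 1 F) (pder 2 F).
Proof.
intros H. split.
- intros. apply Derive_correct. apply (proj1 (H nil t x y) 1%nat).
- intros. apply Derive_correct. apply (proj1 (H nil t x y) 2%nat).
- now apply smooth3_continuous.
- now apply smooth3_continuous, smooth3_pder.
- now apply smooth3_continuous, smooth3_pder.
Qed.

Lemma smooth3_derive_t F t x y : smooth3 F -> is_derive (fun s => F s x y) t (pder 0 F t x y).
Proof. intros H. apply Derive_correct. apply (proj1 (H nil t x y) 0%nat). Qed.

Lemma continuity_2d_pt_continuous2 F x y : continuous2 F -> continuity_2d_pt F x y.
Proof. intros H. apply continuity_2d_pt_filterlim. apply (H (x, y)). Qed.

Lemma schwarz_tx F t x y : smooth3 F -> pder 0 (pder 1 F) t x y = pder 1 (pder 0 F) t x y.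
Proof.
intros H.
assert (C1 := smooth3_continuous _ (smooth3_pder _ 0 (smooth3_pder _ 1 H))).
assert (C2 := smooth3_continuous _ (smooth3_pder _ 1 (smooth3_pder _ 0 H))).
apply (Schwarz (fun t x => F t x y)).
- exists (mkposreal 1 Rlt_0_1). intros u v _ _. repeat split.
  + apply (proj1 (H nil u v y) 0%nat).
  + apply (proj1 (H nil u v y) 1%nat).
  + apply (proj1 (H (1%nat :: nil) u v y) 0%nat).
  + apply (proj1 (H (0%nat :: nil) u v y) 1%nat).
- apply (continuity_2d_pt_continuous2 (fun t x => pder 0 (pder 1 F) t x y)). cts.
- apply (continuity_2d_pt_continuous2 (fun t x => pder 1 (pder 0 F) t x y)). cts.
Qed.

Lemma schwarz_ty F t x y : smooth3 F -> pder 0 (pder 2 F) t x y = pder 2 (pder 0 F) t x y.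
Proof.
intros H.
assert (C1 := smooth3_continuous _ (smooth3_pder _ 0 (smooth3_pder _ 2 H))).
assert (C2 := smooth3_continuous _ (smooth3_pder _ 2 (smooth3_pder _ 0 H))).
apply (Schwarz (fun t y => F t x y)).
- exists (mkposreal 1 Rlt_0_1). intros u v _ _. repeat split.
  + apply (proj1 (H nil u x v) 0%nat).
  + apply (proj1 (H nil u x v) 2%nat).
  + apply (proj1 (H (2%nat :: nil) u x v) 0%nat).
  + apply (proj1 (H (0%nat :: nil) u x v) 2%nat).
- apply (continuity_2d_pt_continuous2 (fun t y => pder 0 (pder 2 F) t x y)). cts.
- apply (continuity_2d_pt_continuous2 (fun t y => pder 2 (pder 0 F) t x y)). cts.
Qed.

Lemma schwarz_xy F t x y : smooth3 F -> pder 1 (pder 2 F) t x y = pder 2 (pder 1 F) t x y.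
Proof.
intros H.
assert (C1 := smooth3_continuous _ (smooth3_pder _ 1 (smooth3_pder _ 2 H))).
assert (C2 := smooth3_continuous _ (smooth3_pder _ 2 (smooth3_pder _ 1 H))).
apply (Schwarz (fun x y => F t x y)).
- exists (mkposreal 1 Rlt_0_1). intros u v _ _. repeat split.
  + apply (proj1 (H nil t u v) 1%nat).
  + apply (proj1 (H nil t u v) 2%nat).
  + apply (proj1 (H (2%nat :: nil) t u v) 1%nat).
  + apply (proj1 (H (1%nat :: nil) t u v) 2%nat).
- apply (continuity_2d_pt_continuous2 (fun x y => pder 1 (pder 2 F) t x y)). cts.
- apply (continuity_2d_pt_continuous2 (fun x y => pder 2 (pder 1 F) t x y)). cts.
Qed.

(** * Bounds on compact sets and vanishing at the boundary *)

(** The gauge at p is taken below 1 / (|G(p)| + 1), so the uniform lower bound for the gauge that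
    compactness provides is an upper bound for |G|. *)
Lemma box_bound G : continuous3 G ->
  exists M, forall t x y, 0 <= t <= 1 -> -1 <= x <= 1 -> -1 <= y <= 1 -> Rabs (G t x y) <= M.
Proof.
intros C.
set (g := fun p : Compactness.Tn 3 R => G (fst p) (fst (snd p)) (fst (snd (snd p)))).
assert (Hd : forall p : Compactness.Tn 3 R, exists d : posreal, d <= / (Rabs (g p) + 1) /\
   forall q, close_n 3 d q p -> Rabs (g q - g p) < 1).
{ intros [t [x [y []]]].
  destruct (C (t, x, y) (fun z => Rabs (z - G t x y) < 1)) as [d Hd].
  { exists (mkposreal 1 Rlt_0_1). intros z Hz; exact Hz. }
  assert (P : 0 < / (Rabs (G t x y) + 1)).
  { apply Rinv_0_lt_compat. generalize (Rabs_pos (G t x y)); lra. }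
  assert (P' : 0 < Rmin d (/ (Rabs (G t x y) + 1))) by (apply Rmin_pos; [apply cond_pos|auto]).
  exists (mkposreal _ P'). simpl. split; [apply Rmin_r|].
  intros [t' [x' [y' []]]] (Ht & Hx & Hy & _). unfold g; simpl.
  apply (Hd (t', x', y')). split; [split|]; simpl;
    (eapply Rlt_le_trans; [eassumption|apply Rmin_l]). }
destruct (choice _ Hd) as [d Hd'].
destruct (compactness_value 3 (0, (-1, (-1, tt))) (1, (1, (1, tt))) d) as [e He].
exists (/ e + 1). intros t x y Ht Hx Hy. apply NNPP. intros Hn.
apply (He (t, (x, (y, tt)))); [simpl; tauto|].
intros [p [_ [Hc Hle]]]. apply Hn.
destruct (Hd' p) as [D1 D2]. specialize (D2 _ Hc). unfold g at 1 in D2; simpl in D2.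
assert (B : Rabs (g p) + 1 <= / e).
{ rewrite <- (Rinv_inv (Rabs (g p) + 1)). apply Rinv_le_contravar; [apply cond_pos|lra]. }
replace (G t x y) with ((G t x y - g p) + g p) by ring.
eapply Rle_trans; [apply Rabs_triang|]. lra.
Qed.

(** The function r(t) exp(-K t) starts at 0 and has nonpositive derivative, while r is
    nonnegative. *)
Lemma gronwall_zero (r dr : R -> R) (K : R) : (forall t, is_derive r t (dr t)) -> r 0 = 0 ->
  (forall t, 0 <= t <= 1 -> 0 <= r t /\ dr t <= K * r t) ->
  forall t, 0 <= t <= 1 -> r t = 0.
Proof.
intros D r0 B t Ht.
set (q := fun t => r t * exp (- K * t)).
assert (Dq : forall t, is_derive q t (dr t * exp (- K * t) + r t * (- K * exp (- K * t)))).
{ intros z. apply (is_derive_mult_R r (fun t => exp (- K * t))); auto.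
  auto_derive; auto; ring. }
destruct (MVT_gen q 0 t (fun t => dr t * exp (- K * t) + r t * (- K * exp (- K * t)))) as [c [Hc E]].
- intros; apply Dq.
- intros x _. apply derivable_continuous_pt. eexists. apply is_derive_Reals, Dq.
- rewrite Rmin_left, Rmax_right in Hc by lra.
  destruct (B c ltac:(lra)) as [_ B2]. destruct (B t Ht) as [B1 _].
  assert (X1 := exp_pos (- K * c)). assert (X2 := exp_pos (- K * t)).
  unfold q in E. rewrite r0 in E.
  assert (r t * exp (- K * t) <= 0).
  { assert ((dr c - K * r c) * exp (- K * c) * t <= 0); [|lra].
    assert ((K * r c - dr c) * exp (- K * c) * t >= 0); [|lra].
    apply Rle_ge, Rmult_le_pos; [apply Rmult_le_pos|]; lra. }
  nra.
Qed.

Lemma polar x y : exists rho th, 0 <= rho /\ x = rho * cos th /\ y = rho * sin th.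
Proof.
set (rho := sqrt (x * x + y * y)).
assert (S : rho * rho = x * x + y * y) by (apply sqrt_sqrt; nra).
destruct (sqrt_pos (x * x + y * y)) as [H|H]; fold rho in H.
- destruct (circle_angle (x / rho) (y / rho)) as [th [Hx Hy]].
  + replace (x / rho * (x / rho) + y / rho * (y / rho)) with ((x * x + y * y) / (rho * rho))
      by (field; lra).
    rewrite S. field. nra.
  + exists rho, th. rewrite <- Hx, <- Hy. repeat split; [lra|field; lra|field; lra].
- exists 0, 0. rewrite <- H in S. nra.
Qed.

(** The mean value theorem along the radius gives |w| <= M (1 - rho), and 1 - rho <= 1 - rho^2 on
    the disk. The form 1 - rho^2 is the one that a Gronwall estimate for 1 - |h_t|^2 requires. *)
Lemma vanishing_on_circle_bound w wx wy : is_C1 w wx wy ->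
  (forall t th, 0 <= t <= 1 -> w t (cos th) (sin th) = 0) ->
  exists M, forall t x y, 0 <= t <= 1 -> x * x + y * y <= 1 ->
    Rabs (w t x y) <= M * (1 - (x * x + y * y)).
Proof.
intros [W1 W2 W3 W4 W5] H0.
destruct (box_bound wx W4) as [M1 HM1]. destruct (box_bound wy W5) as [M2 HM2].
exists (M1 + M2). intros t x y Ht Hxy.
destruct (polar x y) as [rho [th [Hr [Hx Hy]]]].
assert (S := sin2_cos2 th). unfold Rsqr in S.
assert (E : x * x + y * y = rho * rho) by (subst; nra). rewrite E in *.
assert (Hr1 : rho <= 1) by nra.
assert (Ds : forall c r, is_derive (fun r => r * c) r c) by (intros; auto_derive; auto; ring).
assert (D : forall r, is_derive (fun r => w t (r * cos th) (r * sin th)) r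
   (wx t (r * cos th) (r * sin th) * cos th + wy t (r * cos th) (r * sin th) * sin th)).
{ intros r. apply (chain2 (w t) (wx t) (wy t) (fun r => r * cos th) (fun r => r * sin th)); auto.
  cts. }
destruct (MVT_gen (fun r => w t (r * cos th) (r * sin th)) rho 1
  (fun r => wx t (r * cos th) (r * sin th) * cos th + wy t (r * cos th) (r * sin th) * sin th))
  as [c [Hc Ec]].
- intros; apply D.
- intros z _. apply derivable_continuous_pt. eexists. apply is_derive_Reals, D.
- rewrite Rmin_left, Rmax_right in Hc by lra.
  cbv beta in Ec. rewrite !Rmult_1_l, H0, <- Hx, <- Hy in Ec by auto.
  assert (Bc := COS_bound th). assert (Bs := SIN_bound th).
  specialize (HM1 t (c * cos th) (c * sin th) Ht ltac:(nra) ltac:(nra)).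
  specialize (HM2 t (c * cos th) (c * sin th) Ht ltac:(nra) ltac:(nra)).
  replace (w t x y) with
    (- ((wx t (c * cos th) (c * sin th) * cos th + wy t (c * cos th) (c * sin th) * sin th)
    * (1 - rho))) by lra.
  rewrite Rabs_Ropp, Rabs_mult, (Rabs_right (1 - rho)) by lra.
  assert (B : Rabs (wx t (c * cos th) (c * sin th) * cos th +
    wy t (c * cos th) (c * sin th) * sin th) <= M1 + M2).
  { eapply Rle_trans; [apply Rabs_triang|]. rewrite !Rabs_mult.
    assert (Rabs (cos th) <= 1) by (apply Rabs_le; lra).
    assert (Rabs (sin th) <= 1) by (apply Rabs_le; lra).
    assert (P1 := Rabs_pos (wx t (c * cos th) (c * sin th))).
    assert (P2 := Rabs_pos (wy t (c * cos th) (c * sin th))). nra. }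
  assert (P0 := Rabs_pos (wx t (c * cos th) (c * sin th) * cos th +
    wy t (c * cos th) (c * sin th) * sin th)).
  apply Rle_trans with ((M1 + M2) * (1 - rho)).
  + apply Rmult_le_compat_r; lra.
  + apply Rmult_le_compat_l; nra.
Qed.

Lemma zero_at_1 (g : R -> R) : continuous1 g -> (forall s, 0 <= s < 1 -> g s = 0) -> g 1 = 0.
Proof.
intros C H. apply NNPP. intros Hn.
assert (P : 0 < Rabs (g 1)) by now apply Rabs_pos_lt.
destruct (C 1 (fun z => Rabs (z - g 1) < Rabs (g 1))) as [d Hd].
{ exists (mkposreal _ P). intros z Hz; exact Hz. }
assert (Hd0 := cond_pos d).
set (s := Rmax 0 (1 - d / 2)).
assert (Hs : 0 <= s < 1).
{ unfold s; split; [apply Rmax_l|apply Rmax_lub_lt; lra]. }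
assert (B : ball 1 d s).
{ apply (Rabs_def1 (s - 1) d); [lra|]. assert (1 - d / 2 <= s) by apply Rmax_r. lra. }
specialize (Hd s B). simpl in Hd. rewrite (H s Hs) in Hd.
replace (0 - g 1) with (- g 1) in Hd by ring. rewrite Rabs_Ropp in Hd. lra.
Qed.

Lemma locally_in_interval (K : R -> R) (x c : R) : continuous1 K -> K x < c ->
  locally x (fun z => K z < c).
Proof.
intros C H. apply (C x (fun z => z < c)). apply (open_lt c (K x) H).
Qed.

(** Interior points have a neighbourhood in the disk on which [K] vanishes. At a boundary point a
    coordinate segment may leave the disk on both sides, so the derivatives are obtained there as
    radial limits. *)
Lemma zero_in_disk_derive K Kx Ky t : is_C1 K Kx Ky ->
  (forall x y, in_disk (x, y) -> K t x y = 0) ->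
  forall x y, in_disk (x, y) -> Kx t x y = 0 /\ Ky t x y = 0.
Proof.
intros [K1 K2 K3 K4 K5] H.
assert (I : forall x y, x * x + y * y < 1 -> Kx t x y = 0 /\ Ky t x y = 0).
{ intros x y Hxy. split.
  - rewrite <- (is_derive_unique _ _ _ (K1 t x y)).
    rewrite (Derive_ext_loc _ (fun _ => 0)); [apply Derive_const|].
    generalize (locally_in_interval (fun z => z * z + y * y) x 1 ltac:(cts) Hxy).
    apply filter_imp. intros z Hz. apply H. unfold in_disk; simpl; lra.
  - rewrite <- (is_derive_unique _ _ _ (K2 t x y)).
    rewrite (Derive_ext_loc _ (fun _ => 0)); [apply Derive_const|].
    generalize (locally_in_interval (fun z => x * x + z * z) y 1 ltac:(cts) Hxy).
    apply filter_imp. intros z Hz. apply H. unfold in_disk; simpl; lra. }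
intros x y Hxy. unfold in_disk in Hxy; simpl in Hxy.
assert (J : forall s, 0 <= s < 1 -> Kx t (s * x) (s * y) = 0 /\ Ky t (s * x) (s * y) = 0).
{ intros s Hs. apply I. assert (0 <= x * x + y * y <= 1) by nra.
  replace (s * x * (s * x) + s * y * (s * y)) with (s * s * (x * x + y * y)) by ring. nra. }
rewrite <- (Rmult_1_l x), <- (Rmult_1_l y). split.
- apply (zero_at_1 (fun s => Kx t (s * x) (s * y))); [cts|]. intros; now apply J.
- apply (zero_at_1 (fun s => Ky t (s * x) (s * y))); [cts|]. intros; now apply J.
Qed.

Lemma eq_in_disk_derive F Fx Fy G Gx Gy t : is_C1 F Fx Fy -> is_C1 G Gx Gy ->
  (forall x y, in_disk (x, y) -> F t x y = G t x y) ->
  forall x y, in_disk (x, y) -> Fx t x y = Gx t x y /\ Fy t x y = Gy t x y.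
Proof.
intros HF HG E x y Hxy.
destruct (zero_in_disk_derive _ _ _ t (C1_minus _ _ _ _ _ _ HF HG)) with x y as [A B]; auto.
- intros; rewrite E by auto; ring.
- simpl in A, B. split; lra.
Qed.

(** * The action of a Hamiltonian isotopy *)


Lemma C1_plane_cont K Kx Ky : is_C1 (fun _ => K) (fun _ => Kx) (fun _ => Ky) ->
  continuous2 K /\ continuous2 Kx /\ continuous2 Ky.
Proof.
intros [_ _ A B C]. repeat split; intros p.
- apply (continuous3_comp _ _ (fun _ => 0) fst snd p A); cts.
- apply (continuous3_comp _ _ (fun _ => 0) fst snd p B); cts.
- apply (continuous3_comp _ _ (fun _ => 0) fst snd p C); cts.
Qed.

(** The coefficient of d theta in the restriction of eta to the circle. *)
Definition circle_density (P Q : R -> R -> R) (th : R) : R :=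
  Q (cos th) (sin th) * cos th - P (cos th) (sin th) * sin th.

Definition circle_primitive (P Q : R -> R -> R) (th : R) : R :=
  RInt (circle_density P Q) 0 th.

Lemma circle_in_disk th : in_disk (cos th, sin th).
Proof. unfold in_disk; simpl. generalize (sin2_cos2 th); unfold Rsqr; lra. Qed.

Section Isotopy.

Variables h1 h2 f : R -> R -> R -> R.
Variables P Q : R -> R -> R.
Hypothesis h1_smooth : smooth3 h1.
Hypothesis h2_smooth : smooth3 h2.
Hypothesis f_smooth : smooth3 f.
Hypothesis P_C1 : is_C1 (fun _ => P) (fun _ => dx P) (fun _ => dy P).
Hypothesis Q_C1 : is_C1 (fun _ => Q) (fun _ => dx Q) (fun _ => dy Q).
Hypothesis in_disk_h : forall t x y, 0 <= t <= 1 -> in_disk (x, y) ->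
  in_disk (h1 t x y, h2 t x y).
Hypothesis jac_h : forall t x y, 0 <= t <= 1 -> in_disk (x, y) ->
  pder 1 h1 t x y * pder 2 h2 t x y - pder 2 h1 t x y * pder 1 h2 t x y = 1.
Hypothesis h1_0 : forall x y, in_disk (x, y) -> h1 0 x y = x.
Hypothesis h2_0 : forall x y, in_disk (x, y) -> h2 0 x y = y.
Hypothesis ham_x : forall t x y, 0 <= t <= 1 -> in_disk (x, y) ->
  pder 1 f t (h1 t x y) (h2 t x y) = - pder 0 h2 t x y.
Hypothesis ham_y : forall t x y, 0 <= t <= 1 -> in_disk (x, y) ->
  pder 2 f t (h1 t x y) (h2 t x y) = pder 0 h1 t x y.
Hypothesis f_circle : forall t th, 0 <= t <= 1 -> f t (cos th) (sin th) = 0.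
Hypothesis dPQ : forall x y, in_disk (x, y) -> dx Q x y - dy P x y = 1.

Let h1_C1 := smooth3_C1 _ h1_smooth.
Let h2_C1 := smooth3_C1 _ h2_smooth.
Let f_C1 := smooth3_C1 _ f_smooth.
Let h2x_C1 := smooth3_C1 _ (smooth3_pder _ 1 h2_smooth).
Let h2y_C1 := smooth3_C1 _ (smooth3_pder _ 2 h2_smooth).
Let h1t_C1 := smooth3_C1 _ (smooth3_pder _ 0 h1_smooth).
Let h2t_C1 := smooth3_C1 _ (smooth3_pder _ 0 h2_smooth).
Let fx_C1 := smooth3_C1 _ (smooth3_pder _ 1 f_smooth).
Let fy_C1 := smooth3_C1 _ (smooth3_pder _ 2 f_smooth).

(** Since f_t is constant on the circle its tangential derivative vanishes, which says that X_t is
    tangent to the circle. *)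
Lemma rotational_derivative_zero t th : 0 <= t <= 1 ->
  pder 2 f t (cos th) (sin th) * cos th - pder 1 f t (cos th) (sin th) * sin th = 0.
Proof.
intros Ht. assert (D := circle_derive _ _ _ t th f_C1).
apply is_derive_unique in D. rewrite <- D.
rewrite (Derive_ext _ (fun _ => 0)); [apply Derive_const|]. auto.
Qed.

(** rho = 1 - |h_t|^2 satisfies rho' = -2 w(t, h_t), where the rotational
    derivative w of the Hamiltonian vanishes on the circle, hence |rho'| <= C rho. *)
Lemma circle_invariant t th : 0 <= t <= 1 ->
  h1 t (cos th) (sin th) * h1 t (cos th) (sin th)
  + h2 t (cos th) (sin th) * h2 t (cos th) (sin th) = 1.
Proof.
intros Ht.
assert (W := C1_minus _ _ _ _ _ _ (C1_mult _ _ _ _ _ _ C1_X fy_C1)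
  (C1_mult _ _ _ _ _ _ C1_Y fx_C1)).
destruct (vanishing_on_circle_bound _ _ _ W) as [M HM].
{ intros s a Hs. rewrite <- (rotational_derivative_zero s a Hs). ring. }
set (x := cos th) in *. set (y := sin th) in *.
assert (Dxy : in_disk (x, y)) by apply circle_in_disk.
set (r := fun t => 1 - (h1 t x y * h1 t x y + h2 t x y * h2 t x y)).
set (dr := fun t => 0 - ((pder 0 h1 t x y * h1 t x y + h1 t x y * pder 0 h1 t x y) +
  (pder 0 h2 t x y * h2 t x y + h2 t x y * pder 0 h2 t x y))).
assert (Dr : forall t, is_derive r t (dr t)).
{ intros s. apply (is_derive_minus_R (fun _ => 1)); [apply (is_derive_const (V := R_NormedModule))|].
  assert (D1 := smooth3_derive_t _ s x y h1_smooth).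
  assert (D2 := smooth3_derive_t _ s x y h2_smooth).
  apply (is_derive_plus_R (fun s => h1 s x y * h1 s x y) (fun s => h2 s x y * h2 s x y)).
  - now apply (is_derive_mult_R (fun s => h1 s x y) (fun s => h1 s x y)).
  - now apply (is_derive_mult_R (fun s => h2 s x y) (fun s => h2 s x y)). }
enough (r t = 0) by (unfold r in *; lra).
apply (gronwall_zero r dr (2 * M)); auto.
- unfold r. rewrite h1_0, h2_0 by auto. unfold x, y.
  generalize (sin2_cos2 th); unfold Rsqr; lra.
- intros s Hs. assert (K := in_disk_h s x y Hs Dxy). unfold in_disk in K; simpl in K.
  assert (B := HM s (h1 s x y) (h2 s x y) Hs ltac:(lra)).
  rewrite ham_x, ham_y in B by auto. apply Rabs_le_between in B.
  unfold r, dr. split; lra.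
Qed.

(** * The lift generated by the isotopy *)

(** The form x dy - y dx on the velocity of h_t(x, y). It equals the rate of change of the angle
    when h_t(x, y) is on the unit circle, and being polynomial it stays regular where no angle
    exists. *)
Definition angular_velocity (t x y : R) : R :=
  h1 t x y * pder 0 h2 t x y - h2 t x y * pder 0 h1 t x y.

Definition lift (t th : R) : R := th + RInt (fun s => angular_velocity s (cos th) (sin th)) 0 t.

Lemma angular_velocity_C1 : exists wx wy, is_C1 angular_velocity wx wy.
Proof.
do 2 eexists. exact (C1_minus _ _ _ _ _ _ (C1_mult _ _ _ _ _ _ h1_C1 h2t_C1)
  (C1_mult _ _ _ _ _ _ h2_C1 h1t_C1)).
Qed.

Lemma lift_0 th : lift 0 th = th.
Proof. unfold lift. rewrite RInt_point. apply Rplus_0_r. Qed.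

Lemma lift_derive_t t th :
  is_derive (fun t => lift t th) t (angular_velocity t (cos th) (sin th)).
Proof.
destruct angular_velocity_C1 as [wx [wy [_ _ C _ _]]].
apply is_derive_eq with (0 + angular_velocity t (cos th) (sin th)); [|ring].
apply (is_derive_plus_R (fun _ => th)); [apply (is_derive_const (V := R_NormedModule))|].
apply (is_derive_RInt_cont (fun s => angular_velocity s (cos th) (sin th))). cts.
Qed.

Lemma lift_derive_th t : exists dF, continuous1 dF /\ forall th, is_derive (lift t) th (dF th).
Proof.
destruct angular_velocity_C1 as [wx [wy W]].
assert (Cw := c1_c _ _ _ W). assert (Cx := c1_cx _ _ _ W). assert (Cy := c1_cy _ _ _ W).
exists (fun th => 1 + RInt (fun s => wy s (cos th) (sin th) * cos th
  - wx s (cos th) (sin th) * sin th) 0 t). split.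
- cts.
- intros th. apply (is_derive_plus_R (fun th => th)); [apply (is_derive_id (K := R_AbsRing))|].
  apply (leibniz (fun th s => angular_velocity s (cos th) (sin th))
    (fun th s => wy s (cos th) (sin th) * cos th - wx s (cos th) (sin th) * sin th)).
  + intros. now apply circle_derive.
  + cts.
  + cts.
Qed.

Lemma lift_continuous : continuous2 lift.
Proof.
destruct angular_velocity_C1 as [wx [wy [_ _ C _ _]]].
intros p. unfold lift.
apply continuous_ext with (fun p => snd p +
  fst p * RInt (fun r => angular_velocity (fst p * r) (cos (snd p)) (sin (snd p))) 0 1).
- intros q. now rewrite <- (RInt_0_scale (fun s => angular_velocity s (cos (snd q)) (sin (snd q))))
    by cts.
- cts.
Qed.

Lemma lift_degree t th : lift t (th + 2 * PI) = lift t th + 2 * PI.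
Proof.
unfold lift. rewrite (RInt_ext_R _ (fun s => angular_velocity s (cos th) (sin th))).
- Rring.
- intros s _. destruct (sin_cos_period th 1) as [E1 E2]. rewrite Rmult_1_r in E1, E2.
  now rewrite E1, E2.
Qed.

(** The velocity is orthogonal to the position, because X_t is tangent at the moving point; in the
    plane it is then a multiple of the position rotated by a right angle. *)
Lemma rotation_on_circle t th : 0 <= t <= 1 ->
  pder 0 h1 t (cos th) (sin th) = - angular_velocity t (cos th) (sin th) * h2 t (cos th) (sin th) /\
  pder 0 h2 t (cos th) (sin th) = angular_velocity t (cos th) (sin th) * h1 t (cos th) (sin th).
Proof.
intros Ht. assert (E := circle_invariant t th Ht).
assert (D := circle_in_disk th).
assert (T : h1 t (cos th) (sin th) * pder 0 h1 t (cos th) (sin th)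
  + h2 t (cos th) (sin th) * pder 0 h2 t (cos th) (sin th) = 0).
{ destruct (circle_angle _ _ E) as [b [E1 E2]].
  generalize (rotational_derivative_zero t b Ht). rewrite <- E1, <- E2.
  rewrite ham_x, ham_y by auto. lra. }
unfold angular_velocity.
revert E T. generalize (h1 t (cos th) (sin th)) (h2 t (cos th) (sin th))
  (pder 0 h1 t (cos th) (sin th)) (pder 0 h2 t (cos th) (sin th)).
intros a b a' b' E T. split.
- transitivity (a' * (a * a + b * b) - a * (a * a' + b * b')); [rewrite E, T; ring|ring].
- transitivity (b' * (a * a + b * b) - b * (a * a' + b * b')); [rewrite E, T; ring|ring].
Qed.

(** The inner product of h_t with (cos, sin) of the lift has zero derivative, since both vectors
    rotate with the same angular velocity, and it is 1 at t = 0. Unit vectors with inner product 1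
    coincide. *)
Lemma lift_correct t th : 0 <= t <= 1 ->
  h1 t (cos th) (sin th) = cos (lift t th) /\ h2 t (cos th) (sin th) = sin (lift t th).
Proof.
intros Ht. set (x := cos th). set (y := sin th).
set (E := fun s => h1 s x y * cos (lift s th) + h2 s x y * sin (lift s th)).
set (om := fun s => angular_velocity s x y).
set (dE := fun s => (pder 0 h1 s x y * cos (lift s th) + h1 s x y * (om s * - sin (lift s th)))
  + (pder 0 h2 s x y * sin (lift s th) + h2 s x y * (om s * cos (lift s th)))).
assert (DE : forall s, is_derive E s (dE s)).
{ intros s. assert (L := lift_derive_t s th).
  apply (is_derive_plus_R (fun s => h1 s x y * cos (lift s th))
    (fun s => h2 s x y * sin (lift s th))).
  - apply (is_derive_mult_R (fun s => h1 s x y) (fun s => cos (lift s th))).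
    + now apply smooth3_derive_t.
    + apply (is_derive_comp_R cos (fun s => lift s th)); [apply is_derive_cos|exact L].
  - apply (is_derive_mult_R (fun s => h2 s x y) (fun s => sin (lift s th))).
    + now apply smooth3_derive_t.
    + apply (is_derive_comp_R sin (fun s => lift s th)); [apply is_derive_sin|exact L]. }
assert (Et : E t = 1).
{ destruct (MVT_gen E 0 t dE) as [c [Hc EE]].
  - intros; apply DE.
  - intros z _. apply derivable_continuous_pt. eexists. apply is_derive_Reals, DE.
  - rewrite Rmin_left, Rmax_right in Hc by lra.
    assert (dE c = 0).
    { unfold dE. destruct (rotation_on_circle c th ltac:(lra)) as [R1 R2].
      fold x y in R1, R2. rewrite R1, R2. unfold om. ring. }
    assert (E 0 = 1).
    { unfold E. rewrite h1_0, h2_0, lift_0 by apply circle_in_disk.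
      generalize (sin2_cos2 th). unfold x, y, Rsqr. lra. }
    rewrite H in EE. lra. }
assert (I := circle_invariant t th Ht). fold x y in I. unfold E in Et.
assert (S := sin2_cos2 (lift t th)). unfold Rsqr in S.
set (a := h1 t x y) in *. set (b := h2 t x y) in *.
set (c := cos (lift t th)) in *. set (d := sin (lift t th)) in *.
assert ((a - c) * (a - c) + (b - d) * (b - d) = 0) by lra.
assert (0 <= (a - c) * (a - c)) by nra. assert (0 <= (b - d) * (b - d)) by nra.
split; nra.
Qed.

Lemma isotopy_preserves_area psi psix psiy t : 0 <= t <= 1 -> is_C1 psi psix psiy ->
  disk_int_rect (fun x y => psi t (h1 t x y) (h2 t x y)) = disk_int_rect (psi t).
Proof.
intros Ht Hpsi. destruct (lift_derive_th t) as [dF [CdF DF]].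
apply (change_of_variables psi psix psiy _ _ _ _ _ _ _ _ _ _ t (lift t) dF Hpsi
  h1_C1 h2_C1 h2x_C1 h2y_C1); auto.
- intros. symmetry. now apply schwarz_xy.
- intros; now apply lift_correct.
- intros; now apply lift_correct.
- rewrite <- lift_degree. f_equal. ring.
Qed.

(** * The action function and its integral *)

Definition action_density (t x y : R) : R :=
  P (h1 t x y) (h2 t x y) * pder 0 h1 t x y + Q (h1 t x y) (h2 t x y) * pder 0 h2 t x y
  + f t (h1 t x y) (h2 t x y).

Definition action (x y : R) : R := RInt (fun t => action_density t x y) 0 1.

Let P_cont := proj1 (C1_plane_cont _ _ _ P_C1).
Let Q_cont := proj1 (C1_plane_cont _ _ _ Q_C1).

(** Cartan's formula: d/dt (h_t^* eta) = d (h_t^* (eta(X_t) + f_t)). *)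
Lemma action_C1 : exists phix phiy,
  is_C1 (fun _ => action) (fun _ => phix) (fun _ => phiy) /\
  (forall x y, in_disk (x, y) ->
     phix x y = P (h1 1 x y) (h2 1 x y) * pder 1 h1 1 x y
       + Q (h1 1 x y) (h2 1 x y) * pder 1 h2 1 x y - P x y /\
     phiy x y = P (h1 1 x y) (h2 1 x y) * pder 2 h1 1 x y
       + Q (h1 1 x y) (h2 1 x y) * pder 2 h2 1 x y - Q x y).
Proof.
assert (Ph := C1_comp _ _ _ _ _ _ _ _ _ P_C1 h1_C1 h2_C1).
assert (Qh := C1_comp _ _ _ _ _ _ _ _ _ Q_C1 h1_C1 h2_C1).
assert (fh := C1_comp _ _ _ _ _ _ _ _ _ f_C1 h1_C1 h2_C1).
assert (T := C1_plus _ _ _ _ _ _ (C1_plus _ _ _ _ _ _ (C1_mult _ _ _ _ _ _ Ph h1t_C1)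
  (C1_mult _ _ _ _ _ _ Qh h2t_C1)) fh).
assert (Phi := C1_RInt _ _ _ 0 1 T).
do 2 eexists. split; [exact Phi|]. clear Phi. intros x y Hxy.
assert (dK : forall K, is_C1 (fun _ => K) (fun _ => dx K) (fun _ => dy K) -> forall t,
  is_derive (fun t => K (h1 t x y) (h2 t x y)) t
    (dx K (h1 t x y) (h2 t x y) * pder 0 h1 t x y + dy K (h1 t x y) (h2 t x y) * pder 0 h2 t x y)).
{ intros K HK t. destruct (C1_plane_cont _ _ _ HK) as [CK [CKx CKy]]. destruct HK as [K1 K2 C0 Cx Cy].
  apply (chain2 K (dx K) (dy K) (fun t => h1 t x y) (fun t => h2 t x y)); auto.
  - now apply smooth3_derive_t.
  - now apply smooth3_derive_t. }
(* The time-zero map is the identity on the disk only, so even its Jacobian matrix at boundary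
   points has to be deduced. *)
destruct (eq_in_disk_derive _ _ _ _ _ _ 0 h1_C1 C1_X h1_0 x y Hxy) as [h1x0 h1y0].
destruct (eq_in_disk_derive _ _ _ _ _ _ 0 h2_C1 C1_Y h2_0 x y Hxy) as [h2x0 h2y0].
destruct (C1_plane_cont _ _ _ P_C1) as [P_cont' [Px_cont Py_cont]].
destruct (C1_plane_cont _ _ _ Q_C1) as [Q_cont' [Qx_cont Qy_cont]].
assert (c1 := smooth3_continuous _ h1_smooth). assert (c2 := smooth3_continuous _ h2_smooth).
(* For d = 1, 2 the integrand is the [d]-derivative of the action density, and the right side is the
   change over [0, 1] of the corresponding coefficient of the pullback of eta. *)
assert (main : forall d, d = 1%nat \/ d = 2%nat ->
  (forall t, pder 0 (pder d h1) t x y = pder d (pder 0 h1) t x y) ->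
  (forall t, pder 0 (pder d h2) t x y = pder d (pder 0 h2) t x y) ->
  RInt (fun t =>
    (dx P (h1 t x y) (h2 t x y) * pder d h1 t x y + dy P (h1 t x y) (h2 t x y) * pder d h2 t x y)
      * pder 0 h1 t x y + P (h1 t x y) (h2 t x y) * pder d (pder 0 h1) t x y
    + ((dx Q (h1 t x y) (h2 t x y) * pder d h1 t x y + dy Q (h1 t x y) (h2 t x y) * pder d h2 t x y)
      * pder 0 h2 t x y + Q (h1 t x y) (h2 t x y) * pder d (pder 0 h2) t x y)
    + (pder 1 f t (h1 t x y) (h2 t x y) * pder d h1 t x y
      + pder 2 f t (h1 t x y) (h2 t x y) * pder d h2 t x y)) 0 1
  = P (h1 1 x y) (h2 1 x y) * pder d h1 1 x y + Q (h1 1 x y) (h2 1 x y) * pder d h2 1 x y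
    - (P (h1 0 x y) (h2 0 x y) * pder d h1 0 x y + Q (h1 0 x y) (h2 0 x y) * pder d h2 0 x y)).
{ intros d _ S1 S2.
  assert (cd1 := smooth3_continuous _ (smooth3_pder _ d h1_smooth)).
  assert (cd2 := smooth3_continuous _ (smooth3_pder _ d h2_smooth)).
  assert (ct1 := smooth3_continuous _ (smooth3_pder _ 0 h1_smooth)).
  assert (ct2 := smooth3_continuous _ (smooth3_pder _ 0 h2_smooth)).
  assert (ctd1 := smooth3_continuous _ (smooth3_pder _ 0 (smooth3_pder _ d h1_smooth))).
  assert (ctd2 := smooth3_continuous _ (smooth3_pder _ 0 (smooth3_pder _ d h2_smooth))).
  rewrite <- (RInt_FTC (fun t => P (h1 t x y) (h2 t x y) * pder d h1 t x y
     + Q (h1 t x y) (h2 t x y) * pder d h2 t x y)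
    (fun t => ((dx P (h1 t x y) (h2 t x y) * pder 0 h1 t x y
        + dy P (h1 t x y) (h2 t x y) * pder 0 h2 t x y) * pder d h1 t x y
       + P (h1 t x y) (h2 t x y) * pder 0 (pder d h1) t x y)
     + ((dx Q (h1 t x y) (h2 t x y) * pder 0 h1 t x y
        + dy Q (h1 t x y) (h2 t x y) * pder 0 h2 t x y) * pder d h2 t x y
       + Q (h1 t x y) (h2 t x y) * pder 0 (pder d h2) t x y))).
  - apply RInt_ext_R. intros t Ht. rewrite Rmin_left, Rmax_right in Ht by lra.
    rewrite ham_x, ham_y, S1, S2 by (auto; lra).
    (* The two integrands differ by the factor Qx - Py - 1 at h_t(x, y) times a 2 x 2 minor of
       derivatives of h_t, and this factor is 0. *)
    assert (E := dPQ _ _ (in_disk_h t x y ltac:(lra) Hxy)).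
    replace (dx Q (h1 t x y) (h2 t x y)) with (1 + dy P (h1 t x y) (h2 t x y)) by lra. ring.
  - intros t.
    apply (is_derive_plus_R (fun t => P (h1 t x y) (h2 t x y) * pder d h1 t x y)
      (fun t => Q (h1 t x y) (h2 t x y) * pder d h2 t x y)).
    + apply (is_derive_mult_R (fun t => P (h1 t x y) (h2 t x y)) (fun t => pder d h1 t x y)); auto.
      apply smooth3_derive_t. now apply smooth3_pder.
    + apply (is_derive_mult_R (fun t => Q (h1 t x y) (h2 t x y)) (fun t => pder d h2 t x y)); auto.
      apply smooth3_derive_t. now apply smooth3_pder.
  - cts. }
split.
- rewrite (main 1%nat); [|tauto|intros; now apply schwarz_tx|intros; now apply schwarz_tx].
  rewrite h1x0, h2x0, h1_0, h2_0 by auto. ring.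
- rewrite (main 2%nat); [|tauto|intros; now apply schwarz_ty|intros; now apply schwarz_ty].
  rewrite h1y0, h2y0, h1_0, h2_0 by auto. ring.
Qed.

(** As f_t vanishes on the circle, the density there is the angular velocity times the coefficient
    of eta at the moving angle, hence the time derivative of the primitive along the lift. *)
Lemma action_circle th :
  action (cos th) (sin th) = circle_primitive P Q (lift 1 th) - circle_primitive P Q th.
Proof.
assert (Cu : continuous1 (circle_density P Q)) by (unfold circle_density; cts).
destruct angular_velocity_C1 as [wx [wy [_ _ Cw _ _]]].
assert (CL := lift_continuous).
replace (circle_primitive P Q th) with (circle_primitive P Q (lift 0 th)) by now rewrite lift_0.
rewrite <- (RInt_FTC (fun t => circle_primitive P Q (lift t th))
  (fun t => angular_velocity t (cos th) (sin th) * circle_density P Q (lift t th))).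
- apply RInt_ext_R. intros t Ht. rewrite Rmin_left, Rmax_right in Ht by lra.
  unfold action_density, circle_density.
  destruct (rotation_on_circle t th ltac:(lra)) as [R1 R2]. rewrite R1, R2.
  destruct (lift_correct t th ltac:(lra)) as [L1 L2]. rewrite L1, L2, f_circle by lra. ring.
- intros t. apply (is_derive_comp_R (circle_primitive P Q) (fun t => lift t th)).
  + now apply is_derive_RInt_cont.
  + apply lift_derive_t.
- cts.
Qed.

Lemma disk_int_action :
  disk_int_rect action = 2 * RInt (fun t => disk_int_rect (f t)) 0 1.
Proof.
assert (c1 := smooth3_continuous _ h1_smooth). assert (c2 := smooth3_continuous _ h2_smooth).
assert (ct1 := smooth3_continuous _ (smooth3_pder _ 0 h1_smooth)).
assert (ct2 := smooth3_continuous _ (smooth3_pder _ 0 h2_smooth)).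
assert (cf := smooth3_continuous _ f_smooth).
assert (cfx := smooth3_continuous _ (smooth3_pder _ 1 f_smooth)).
assert (cfy := smooth3_continuous _ (smooth3_pder _ 2 f_smooth)).
destruct (C1_plane_cont _ _ _ P_C1) as [P_cont' [Px_cont Py_cont]].
destruct (C1_plane_cont _ _ _ Q_C1) as [Q_cont' [Qx_cont Qy_cont]].
assert (cP := P_cont). assert (cQ := Q_cont).
unfold action. rewrite disk_int_rect_RInt by (unfold action_density; cts).
rewrite <- RInt_scal_c by (unfold disk_int_rect; cts).
apply RInt_ext_R. intros t Ht. rewrite Rmin_left, Rmax_right in Ht by lra.
(* In terms of f_t the field is X_t = (f_y, - f_x), so eta(X_t) + f_t = P f_y - Q f_x + f. *)
assert (Psi := C1_plus _ _ _ _ _ _ (C1_minus _ _ _ _ _ _ (C1_mult _ _ _ _ _ _ P_C1 fy_C1)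
  (C1_mult _ _ _ _ _ _ Q_C1 fx_C1)) f_C1).
transitivity (disk_int_rect (fun x y =>
   P x y * pder 2 f t x y - Q x y * pder 1 f t x y + f t x y)).
- rewrite <- (isotopy_preserves_area _ _ _ t ltac:(lra) Psi).
  apply disk_int_rect_ext. intros x y Hxy. unfold action_density.
  rewrite ham_x, ham_y by (auto; lra). ring.
(* The boundary term of f_t eta vanishes, which makes the integral of P f_y - Q f_x equal to that of
   f; this is the origin of the factor 2. *)
- assert (G := green _ _ _ _ _ _ t (C1_mult _ _ _ _ _ _ f_C1 P_C1)
    (C1_mult _ _ _ _ _ _ f_C1 Q_C1)). cbv beta in G.
  assert (Z : circle_int (fun x y => f t x y * P x y) (fun x y => f t x y * Q x y) = 0).
  { unfold circle_int. rewrite (RInt_ext_R _ (fun _ => 0)).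
    - rewrite RInt_const_R. ring.
    - intros th _. rewrite f_circle by lra. ring. }
  rewrite Z in G.
  replace (2 * disk_int_rect (f t)) with (2 * disk_int_rect (f t) - 0) by ring.
  rewrite <- G.
  transitivity ((disk_int_rect (f t) + disk_int_rect (f t))
    - disk_int_rect (fun x y => pder 1 f t x y * Q x y + f t x y * dx Q x y -
        (pder 2 f t x y * P x y + f t x y * dy P x y))); [|ring].
  rewrite <- disk_int_rect_plus by cts.
  rewrite <- (disk_int_rect_minus (fun x y => f t x y + f t x y)) by cts.
  apply disk_int_rect_ext. intros x y Hxy.
  replace (dx Q x y) with (1 + dy P x y) by (rewrite <- (dPQ x y Hxy); ring). ring.
Qed.

End Isotopy.

(** * Iterates *)


Lemma smooth2_C1 K : smooth2 K -> is_C1 (fun _ => K) (fun _ => dx K) (fun _ => dy K).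
Proof. exact (smooth3_C1 (fun _ x y => K x y)). Qed.

(** The end of the isotopy and the given map agree only on the disk. At interior points this also
    fixes their derivatives, and the integral only sees interior points. *)
Lemma tau_ext P Q g g' : (forall p, in_disk p -> g p = g' p) -> tau P Q g = tau P Q g'.
Proof.
intros E. apply disk_int_ext. intros x y Hxy.
assert (Ex : locally x (fun z => g (z, y) = g' (z, y))).
{ generalize (locally_in_interval (fun z => z * z + y * y) x 1 ltac:(cts) ltac:(lra)).
  apply filter_imp. intros z Hz. apply E. unfold in_disk; simpl; lra. }
assert (Ey : locally y (fun z => g (x, z) = g' (x, z))).
{ generalize (locally_in_interval (fun z => x * x + z * z) y 1 ltac:(cts) ltac:(lra)).
  apply filter_imp. intros z Hz. apply E. unfold in_disk; simpl; lra. }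
unfold dx, dy, comp1, comp2. rewrite (E (x, y)) by (unfold in_disk; simpl; lra).
rewrite (Derive_ext_loc (fun s => fst (g (s, y))) (fun s => fst (g' (s, y)))),
  (Derive_ext_loc (fun s => snd (g (s, y))) (fun s => snd (g' (s, y)))),
  (Derive_ext_loc (fun s => fst (g (x, s))) (fun s => fst (g' (x, s)))),
  (Derive_ext_loc (fun s => snd (g (x, s))) (fun s => snd (g' (x, s)))); auto.
- revert Ey; apply filter_imp; now intros z ->.
- revert Ey; apply filter_imp; now intros z ->.
- revert Ex; apply filter_imp; now intros z ->.
- revert Ex; apply filter_imp; now intros z ->.
Qed.

(** The relation dphi = g^* eta - eta on the disk. The first derivatives are carried as data, so
    that maps can be composed by the chain rule within class C^1. *)
Definition is_action (P Q : R -> R -> R) (g : R * R -> R * R)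
    (ax ay bx by_ phi phix phiy : R -> R -> R) : Prop :=
  is_C1 (fun _ => comp1 g) (fun _ => ax) (fun _ => ay) /\
  is_C1 (fun _ => comp2 g) (fun _ => bx) (fun _ => by_) /\
  is_C1 (fun _ => phi) (fun _ => phix) (fun _ => phiy) /\
  forall x y, in_disk (x, y) ->
    phix x y = P (comp1 g x y) (comp2 g x y) * ax x y
      + Q (comp1 g x y) (comp2 g x y) * bx x y - P x y /\
    phiy x y = P (comp1 g x y) (comp2 g x y) * ay x y
      + Q (comp1 g x y) (comp2 g x y) * by_ x y - Q x y.

Section Primitive.

Variables P Q : R -> R -> R.
Hypothesis P_C1 : is_C1 (fun _ => P) (fun _ => dx P) (fun _ => dy P).
Hypothesis Q_C1 : is_C1 (fun _ => Q) (fun _ => dx Q) (fun _ => dy Q).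
Hypothesis dPQ : forall x y, in_disk (x, y) -> dx Q x y - dy P x y = 1.

(** d(phi eta) = dphi /\ eta + phi omega, and dphi /\ eta = g^*eta /\ eta. *)
Lemma tau_action g ax ay bx by_ phi phix phiy :
  is_action P Q g ax ay bx by_ phi phix phiy ->
  tau P Q g = RInt (fun th => phi (cos th) (sin th) * circle_density P Q th) (- PI) PI
    - disk_int_rect phi.
Proof.
intros [A [B [C D]]].
assert (G := green _ _ _ _ _ _ 0 (C1_mult _ _ _ _ _ _ C P_C1) (C1_mult _ _ _ _ _ _ C Q_C1)).
cbv beta in G.
destruct (C1_plane_cont _ _ _ P_C1) as [cP [cPx cPy]].
destruct (C1_plane_cont _ _ _ Q_C1) as [cQ [cQx cQy]].
destruct (C1_plane_cont _ _ _ A) as [ca [cax cay]].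
destruct (C1_plane_cont _ _ _ B) as [cb [cbx cby]].
destruct (C1_plane_cont _ _ _ C) as [cphi [cphix cphiy]].
transitivity (disk_int (fun x y =>
  (P (comp1 g x y) (comp2 g x y) * ax x y + Q (comp1 g x y) (comp2 g x y) * bx x y) * Q x y -
  (P (comp1 g x y) (comp2 g x y) * ay x y + Q (comp1 g x y) (comp2 g x y) * by_ x y) * P x y)).
{ apply disk_int_ext. intros x y _.
  assert (E1 : dx (comp1 g) x y = ax x y) by (apply is_derive_unique, (c1_x _ _ _ A 0)).
  assert (E2 : dy (comp1 g) x y = ay x y) by (apply is_derive_unique, (c1_y _ _ _ A 0)).
  assert (E3 : dx (comp2 g) x y = bx x y) by (apply is_derive_unique, (c1_x _ _ _ B 0)).
  assert (E4 : dy (comp2 g) x y = by_ x y) by (apply is_derive_unique, (c1_y _ _ _ B 0)).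
  cbv zeta. now rewrite E1, E2, E3, E4. }
rewrite disk_int_rectE by cts.
transitivity (circle_int (fun x y => phi x y * P x y) (fun x y => phi x y * Q x y)
  - disk_int_rect phi).
- rewrite <- G, <- disk_int_rect_minus by cts.
  apply disk_int_rect_ext. intros x y Hxy. destruct (D x y Hxy) as [E1 E2].
  rewrite E1, E2.
  replace (dx Q x y) with (1 + dy P x y) by (rewrite <- (dPQ x y Hxy); ring). ring.
- apply (f_equal (fun z => z - disk_int_rect phi)). apply RInt_ext_R. intros th _.
  unfold circle_density. ring.
Qed.

Lemma is_action_id : is_action P Q (fun p => p) (fun _ _ => 1) (fun _ _ => 0) (fun _ _ => 0)
  (fun _ _ => 1) (fun _ _ => 0) (fun _ _ => 0) (fun _ _ => 0).
Proof.
split; [exact C1_X|split; [exact C1_Y|split; [exact (C1_const 0)|]]].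
intros; simpl. split; unfold comp1, comp2; simpl; ring.
Qed.

(** The difference (g k)^* eta - eta is the pullback by k of g^* eta - eta, plus k^* eta - eta; the
    potentials therefore add as a cocycle. *)
Lemma is_action_comp g ax ay bx by_ phi phix phiy k ax' ay' bx' by' psi psix psiy :
  (forall p, in_disk p -> in_disk (k p)) ->
  is_action P Q g ax ay bx by_ phi phix phiy ->
  is_action P Q k ax' ay' bx' by' psi psix psiy ->
  exists ax'' ay'' bx'' by'' phix'' phiy'',
    is_action P Q (fun p => g (k p)) ax'' ay'' bx'' by''
      (fun x y => psi x y + phi (comp1 k x y) (comp2 k x y)) phix'' phiy''.
Proof.
intros Hk [A [B [C D]]] [A' [B' [C' D']]].
assert (E : forall x y, (comp1 k x y, comp2 k x y) = k (x, y)).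
{ intros. unfold comp1, comp2. now destruct (k (x, y)). }
assert (A'' := C1_comp _ _ _ _ _ _ _ _ _ A A' B').
assert (B'' := C1_comp _ _ _ _ _ _ _ _ _ B A' B').
assert (C'' := C1_plus _ _ _ _ _ _ C' (C1_comp _ _ _ _ _ _ _ _ _ C A' B')).
cbv beta in A'', B'', C''.
assert (E1 : (fun (_ : R) x y => comp1 g (comp1 k x y) (comp2 k x y))
  = (fun _ => comp1 (fun p => g (k p)))).
{ extensionality t; extensionality x; extensionality y.
  unfold comp1 at 1. now rewrite E. }
assert (E2 : (fun (_ : R) x y => comp2 g (comp1 k x y) (comp2 k x y))
  = (fun _ => comp2 (fun p => g (k p)))).
{ extensionality t; extensionality x; extensionality y.
  unfold comp2 at 1. now rewrite E. }
rewrite E1 in A''. rewrite E2 in B''.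
do 6 eexists. split; [exact A''|split; [exact B''|split; [exact C''|]]].
intros x y Hxy. destruct (D' x y Hxy) as [F1 F2].
assert (K : in_disk (comp1 k x y, comp2 k x y)) by (rewrite E; auto).
destruct (D _ _ K) as [F3 F4]. rewrite F1, F2, F3, F4.
assert (E1' : comp1 g (comp1 k x y) (comp2 k x y) = comp1 (fun p => g (k p)) x y)
  by exact (f_equal (fun h => h 0 x y) E1).
assert (E2' : comp2 g (comp1 k x y) (comp2 k x y) = comp2 (fun p => g (k p)) x y)
  by exact (f_equal (fun h => h 0 x y) E2).
rewrite E1', E2'. split; ring.
Qed.

(** The Birkhoff sum of [phi] along the orbits of [g]. *)
Fixpoint action_sum (g : R * R -> R * R) (phi : R -> R -> R) (n : nat) (x y : R) : R :=
  match n with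
  | O => 0
  | S n => action_sum g phi n x y
           + phi (comp1 (fun p => Nat.iter n g p) x y) (comp2 (fun p => Nat.iter n g p) x y)
  end.

Lemma is_action_iter g ax ay bx by_ phi phix phiy n :
  (forall p, in_disk p -> in_disk (g p)) ->
  is_action P Q g ax ay bx by_ phi phix phiy ->
  exists ax' ay' bx' by' psix psiy,
    is_action P Q (fun p => Nat.iter n g p) ax' ay' bx' by' (action_sum g phi n) psix psiy.
Proof.
intros Hg A. induction n as [|n [ax' [ay' [bx' [by' [psix [psiy IH]]]]]]].
- do 6 eexists. exact is_action_id.
- apply (is_action_comp g ax ay bx by_ phi phix phiy (fun p => Nat.iter n g p)
    ax' ay' bx' by' (action_sum g phi n) psix psiy); auto.
  intros p Hp. clear IH. induction n; simpl; auto.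
Qed.

(** Every summand has the integral of [phi]: area invariance is applied to phi composed with g^m,
    which peels off the innermost [g]. *)
Lemma disk_int_action_sum g ax ay bx by_ phi phix phiy n :
  (forall p, in_disk p -> in_disk (g p)) ->
  (forall psi psix psiy, is_C1 (fun _ => psi) (fun _ => psix) (fun _ => psiy) ->
     disk_int_rect (fun x y => psi (comp1 g x y) (comp2 g x y)) = disk_int_rect psi) ->
  is_action P Q g ax ay bx by_ phi phix phiy ->
  disk_int_rect (action_sum g phi n) = INR n * disk_int_rect phi.
Proof.
intros Hg Harea A. assert (C := proj1 (proj2 (proj2 A))).
assert (I : forall n, exists a a' b b',
  is_C1 (fun _ => comp1 (fun p => Nat.iter n g p)) (fun _ => a) (fun _ => a') /\
  is_C1 (fun _ => comp2 (fun p => Nat.iter n g p)) (fun _ => b) (fun _ => b')).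
{ intros m. destruct (is_action_iter g ax ay bx by_ phi phix phiy m Hg A)
    as [a [a' [b [b' [q [q' [I1 [I2 _]]]]]]]]. now exists a, a', b, b'. }
assert (M : forall m, disk_int_rect (fun x y =>
  phi (comp1 (fun p => Nat.iter m g p) x y) (comp2 (fun p => Nat.iter m g p) x y))
  = disk_int_rect phi).
{ induction m; [reflexivity|]. rewrite <- IHm.
  destruct (I m) as [a [a' [b [b' [I1 I2]]]]].
  rewrite <- (Harea _ _ _ (C1_comp _ _ _ _ _ _ _ _ _ C I1 I2)).
  f_equal. extensionality x; extensionality y.
  unfold comp1, comp2. rewrite <- surjective_pairing, <- Nat.iter_succ_r. reflexivity. }
induction n.
- simpl. unfold disk_int_rect.
  rewrite (RInt_ext_R _ (fun _ => 0)); [rewrite RInt_const_R; ring|].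
  intros a _. rewrite (RInt_ext_R _ (fun _ => 0)); [rewrite RInt_const_R; ring|].
  intros; ring.
- rewrite S_INR. simpl action_sum.
  destruct (is_action_iter g ax ay bx by_ phi phix phiy n Hg A)
    as [a [a' [b [b' [q [q' [I1 [I2 [I3 _]]]]]]]]].
  destruct (C1_plane_cont _ _ _ I1) as [c1 _]. destruct (C1_plane_cont _ _ _ I2) as [c2 _].
  destruct (C1_plane_cont _ _ _ I3) as [c3 _]. destruct (C1_plane_cont _ _ _ C) as [c4 _].
  rewrite disk_int_rect_plus, M, IHn; [ring|cts|cts].
Qed.

(** The Birkhoff sum telescopes along the lifted orbit. *)
Lemma action_sum_circle g phi F n :
  (forall th, g (cos th, sin th) = (cos (F th), sin (F th))) ->
  (forall th, phi (cos th) (sin th) = circle_primitive P Q (F th) - circle_primitive P Q th) ->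
  forall th, action_sum g phi n (cos th) (sin th)
    = circle_primitive P Q (Nat.iter n F th) - circle_primitive P Q th.
Proof.
intros Hg Hphi th.
assert (I : forall n, Nat.iter n g (cos th, sin th)
  = (cos (Nat.iter n F th), sin (Nat.iter n F th))).
{ induction n0; simpl; auto. now rewrite IHn0, Hg. }
induction n; simpl; [ring|].
rewrite IHn. unfold comp1, comp2. rewrite I. simpl. rewrite Hphi. ring.
Qed.

(** * The boundary integral *)

Let circle_density_cont : continuous1 (circle_density P Q).
Proof.
destruct (C1_plane_cont _ _ _ P_C1) as [cP _]. destruct (C1_plane_cont _ _ _ Q_C1) as [cQ _].
unfold circle_density; cts.
Qed.

(** By Green the integral is the same for every primitive of omega; it is evaluated for (x dy - y
    dx) / 2, whose density is constantly 1/2. *)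
Lemma circle_density_total : RInt (circle_density P Q) (- PI) PI = PI :> R.
Proof.
assert (G1 := green _ _ _ _ _ _ 0 P_C1 Q_C1).
assert (G2 := green _ _ _ _ _ _ 0 (C1_mult _ _ _ _ _ _ (C1_const (-1 / 2)) C1_Y)
  (C1_mult _ _ _ _ _ _ (C1_const (1 / 2)) C1_X)).
cbv beta in G1, G2.
transitivity (circle_int P Q); [reflexivity|]. rewrite <- G1.
transitivity (circle_int (fun _ y => -1 / 2 * y) (fun x _ => 1 / 2 * x)).
- rewrite <- G2. apply disk_int_rect_ext. intros x y Hxy. rewrite dPQ by auto. field.
- unfold circle_int. rewrite (RInt_ext_R _ (fun _ => 1 / 2)).
  + rewrite RInt_const_R. field.
  + intros th _. generalize (sin2_cos2 th). unfold Rsqr. intros. lra.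
Qed.

Lemma circle_density_bounded : exists M, 0 <= M /\ forall th, Rabs (circle_density P Q th) <= M.
Proof.
destruct (C1_plane_cont _ _ _ P_C1) as [cP _]. destruct (C1_plane_cont _ _ _ Q_C1) as [cQ _].
destruct (box_bound (fun _ x y => Q x y * x - P x y * y)) as [M HM]; [cts|].
assert (B : forall th, Rabs (circle_density P Q th) <= M).
{ intros th. apply (HM 0 (cos th) (sin th)); [lra|apply COS_bound|apply SIN_bound]. }
exists M. split; auto. eapply Rle_trans; [apply Rabs_pos|apply (B 0)].
Qed.

(** The primitive gains pi per turn; doubled, it satisfies the degree-one relation, and
    [degree_one_Z] becomes available for it. *)
Lemma circle_primitive_degree th :
  2 * circle_primitive P Q (th + 2 * PI) = 2 * circle_primitive P Q th + 2 * PI.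
Proof.
assert (E : RInt (circle_density P Q) th (th + 2 * PI) = PI).
{ rewrite (RInt_periodic _ th (- PI)) by
    (auto; intros x; unfold circle_density; destruct (sin_cos_period x 1) as [E1 E2];
     rewrite Rmult_1_r in E1, E2; now rewrite E1, E2).
  replace (- PI + 2 * PI) with PI by ring. apply circle_density_total. }
unfold circle_primitive.
rewrite <- (RInt_Chasles_c _ 0 th (th + 2 * PI)), E by auto. ring.
Qed.

(** The difference is 2 pi-periodic, so one period suffices: there the primitive is at most 2 pi M
    in absolute value and th / 2 at most pi. *)
Lemma circle_primitive_near_linear :
  exists C, forall th, Rabs (circle_primitive P Q th - th / 2) <= C.
Proof.
destruct circle_density_bounded as [M [M0 HM]]. assert (HPI := PI_RGT_0).
exists (2 * PI * M + PI). intros th.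
set (k := Int_part (th / (2 * PI))).
destruct (base_Int_part (th / (2 * PI))) as [K1 K2]. fold k in K1, K2.
set (r := th - 2 * PI * IZR k).
assert (E : th = 2 * PI * (th / (2 * PI))) by (field; lra).
assert (Hr : 0 <= r <= 2 * PI) by (unfold r; nra).
assert (Et : th = r + 2 * PI * IZR k) by (unfold r; ring).
assert (D := degree_one_Z (fun th => 2 * circle_primitive P Q th) circle_primitive_degree r k).
cbv beta in D. rewrite <- Et in D.
replace (circle_primitive P Q th - th / 2) with (circle_primitive P Q r - r / 2) by lra.
assert (B : Rabs (circle_primitive P Q r) <= 2 * PI * M).
{ eapply Rle_trans.
  - apply (abs_RInt_le_const (circle_density P Q) 0 r M); [lra|now apply ex_RInt_cont1|auto].
  - apply Rmult_le_compat_r; lra. }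
apply Rabs_le_between in B. apply Rabs_le. lra.
Qed.

Lemma circle_action_estimate F : continuous1 F ->
  (forall th, F (th + 2 * PI) = F th + 2 * PI) -> (forall a b, a <= b -> F a <= F b) ->
  exists C, forall n, Rabs
    (RInt (fun th => (circle_primitive P Q (Nat.iter n F th) - circle_primitive P Q th)
       * circle_density P Q th) (- PI) PI - PI / 2 * Nat.iter n F 0) <= C.
Proof.
intros CF Hdeg Hmono.
destruct circle_density_bounded as [M [M0 HM]].
destruct circle_primitive_near_linear as [C HC].
assert (HPI := PI_RGT_0).
(* Here 2 C comes from replacing both primitives by half their argument, pi is half the displacement
   error 2 pi, [M] bounds the density, and the first factor is the length of the interval. *)
exists ((PI - - PI) * ((2 * C + PI) * M)). intros n.
assert (CFn := iter_continuous1 F n CF).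
assert (CU : continuous1 (circle_primitive P Q)).
{ intros x. apply (ex_derive_continuous (V := R_NormedModule)). eexists.
  now apply is_derive_RInt_cont. }
assert (Cu := circle_density_cont).
set (a := Nat.iter n F 0).
replace (PI / 2 * a) with (a / 2 * RInt (circle_density P Q) (- PI) PI)
  by (rewrite circle_density_total; field).
rewrite <- RInt_scal_c by auto.
assert (CFn' : continuous1 (fun th => circle_primitive P Q (Nat.iter n F th))).
{ intros x. apply (continuous1_comp (circle_primitive P Q) _ (fun th => Nat.iter n F th)); auto. }
rewrite <- RInt_minus_c.
2, 3: intros x; cts; first [exact (CFn' x) | cts].
apply abs_RInt_le_const; [lra|apply ex_RInt_cont1|].
{ intros x; cts; exact (CFn' x). }
intros th _.
replace ((circle_primitive P Q (Nat.iter n F th) - circle_primitive P Q th)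
   * circle_density P Q th - a / 2 * circle_density P Q th) with
  ((circle_primitive P Q (Nat.iter n F th) - circle_primitive P Q th - a / 2)
   * circle_density P Q th) by ring.
rewrite Rabs_mult.
apply Rmult_le_compat; try apply Rabs_pos; auto.
assert (B1 := HC (Nat.iter n F th)). assert (B2 := HC th).
assert (B3 := iter_displacement F n th Hdeg Hmono). fold a in B3.
apply Rabs_le_between in B1, B2, B3. apply Rabs_le. lra.
Qed.

End Primitive.

(** * Assembly of the identity *)

Lemma iter_eq_on (A : Type) (S : A -> Prop) (g g' : A -> A) n :
  (forall p, S p -> S (g' p)) -> (forall p, S p -> g p = g' p) ->
  forall p, S p -> Nat.iter n g p = Nat.iter n g' p /\ S (Nat.iter n g' p).
Proof.
intros H1 H2 p Hp. induction n as [|n [I1 I2]]; simpl; auto.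
rewrite I1. auto.
Qed.

Theorem theorem2p6 :
  forall (g : R * R -> R * R), is_symp g ->
  forall (P Q : R -> R -> R), is_primitive P Q ->
  forall (H : R -> R * R -> R * R) (f : R -> R -> R -> R),
    is_symp_isotopy H g -> is_normalized_ham H f ->
  forall (F : R -> R), is_circle_lift g F ->
  exists k : Z,
    tau_bar P Q g / PI ^ 2 + 2 * calabi_R f / PI ^ 2 - transl F = IZR k.
Proof.
intros g _ P Q [P_smooth [Q_smooth dPQ]] H f [S1 [S2 [H_symp H_ends]]] [f_smooth f_ham] F
  [F_cont F_lift].
set (h1 := fun t x y => fst (H t (x, y))) in *.
set (h2 := fun t x y => snd (H t (x, y))) in *.
assert (HPI := PI_RGT_0).
assert (P_C1 := smooth2_C1 P P_smooth). assert (Q_C1 := smooth2_C1 Q Q_smooth).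
assert (H_disk : forall t p, 0 <= t <= 1 -> in_disk p -> in_disk (H t p)).
{ intros t p Ht. apply (H_symp t Ht). }
assert (in_disk_h : forall t x y, 0 <= t <= 1 -> in_disk (x, y) -> in_disk (h1 t x y, h2 t x y)).
{ intros t x y Ht Hxy. unfold h1, h2. rewrite <- surjective_pairing. auto. }
assert (jac_h : forall t x y, 0 <= t <= 1 -> in_disk (x, y) ->
  pder 1 h1 t x y * pder 2 h2 t x y - pder 2 h1 t x y * pder 1 h2 t x y = 1).
{ intros t x y Ht Hxy. apply (H_symp t Ht); auto. }
assert (h1_0 : forall x y, in_disk (x, y) -> h1 0 x y = x).
{ intros x y Hxy. unfold h1. now rewrite (proj1 (H_ends _ Hxy)). }
assert (h2_0 : forall x y, in_disk (x, y) -> h2 0 x y = y).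
{ intros x y Hxy. unfold h2. now rewrite (proj1 (H_ends _ Hxy)). }
assert (ham_x : forall t x y, 0 <= t <= 1 -> in_disk (x, y) ->
  pder 1 f t (h1 t x y) (h2 t x y) = - pder 0 h2 t x y).
{ intros t x y Ht Hxy. apply (f_ham t Ht); auto. }
assert (ham_y : forall t x y, 0 <= t <= 1 -> in_disk (x, y) ->
  pder 2 f t (h1 t x y) (h2 t x y) = pder 0 h1 t x y).
{ intros t x y Ht Hxy. apply (proj1 (f_ham t Ht) (x, y) Hxy). }
assert (f_circle : forall t th, 0 <= t <= 1 -> f t (cos th) (sin th) = 0).
{ intros t th Ht. apply (proj2 (f_ham t Ht) (cos th, sin th)).
  unfold on_circle; simpl. generalize (sin2_cos2 th). unfold Rsqr. lra. }
set (L := lift h1 h2 1).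
assert (L_lift : forall th, H 1 (cos th, sin th) = (cos (L th), sin (L th))).
{ intros th. rewrite (surjective_pairing (H 1 (cos th, sin th))).
  destruct (lift_correct h1 h2 f S1 S2 f_smooth in_disk_h h1_0 h2_0 ham_x ham_y f_circle 1 th
    ltac:(lra)) as [E1 E2].
  exact (f_equal2 pair E1 E2). }
assert (L_cont : continuous1 L).
{ apply continuous2_section, lift_continuous; auto. }
assert (L_deg : forall th, L (th + 2 * PI) = L th + 2 * PI) by (intros; apply lift_degree).
assert (L_mono : forall a b, a <= b -> L a <= L b).
{ apply degree_one_monotone; auto. intros a b E.
  (* Injectivity of the lift: equal images force the boundary points to coincide, so a and b differ
     by 2 pi k, and the degree-one relation turns L(a) = L(b) into 2 pi k = 0. *)
  destruct (H_symp 1 ltac:(lra)) as [_ [_ [_ [Hbij _]]]].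
  destruct (Hbij (cos (L a), sin (L a))) as [p [_ Hp]].
  { apply circle_in_disk. }
  assert (Ea := Hp _ (conj (circle_in_disk a) (L_lift a))).
  assert (Eb : p = (cos b, sin b)).
  { apply Hp. split; [apply circle_in_disk|]. now rewrite L_lift, E. }
  rewrite Ea in Eb. injection Eb as Ec Es.
  destruct (same_angle a b Ec Es) as [k Hk].
  rewrite Hk, (degree_one_Z L L_deg) in E. rewrite Hk. lra. }
destruct (iter_slope_converges L L_deg L_mono) as [ell Hell].
destruct (lifts_differ F L F_cont L_cont) as [k Hk].
{ intros th. assert (E := F_lift th).
  rewrite <- (proj2 (H_ends _ (circle_in_disk th))), L_lift in E. now injection E. }
{ intros th. assert (E := F_lift th).
  rewrite <- (proj2 (H_ends _ (circle_in_disk th))), L_lift in E. now injection E. }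
destruct (action_C1 h1 h2 f P Q S1 S2 f_smooth P_C1 Q_C1 in_disk_h h1_0 h2_0 ham_x ham_y dPQ)
  as [phix [phiy [Phi dPhi]]].
set (phi := action h1 h2 f P Q) in *.
assert (A : is_action P Q (H 1) (pder 1 h1 1) (pder 2 h1 1) (pder 1 h2 1) (pder 2 h2 1)
  phi phix phiy).
{ split; [|split; [|split]].
  - exact (C1_at _ _ _ 1 (smooth3_C1 _ S1)).
  - exact (C1_at _ _ _ 1 (smooth3_C1 _ S2)).
  - exact Phi.
  - exact dPhi. }
assert (G_disk : forall p, in_disk p -> in_disk (H 1 p)) by (intros; apply H_disk; auto; lra).
assert (G_area : forall psi psix psiy, is_C1 (fun _ => psi) (fun _ => psix) (fun _ => psiy) ->
  disk_int_rect (fun x y => psi (comp1 (H 1) x y) (comp2 (H 1) x y)) = disk_int_rect psi).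
{ intros psi psix psiy Hpsi.
  apply (isotopy_preserves_area h1 h2 f S1 S2 f_smooth in_disk_h jac_h h1_0 h2_0 ham_x ham_y
    f_circle (fun _ => psi) (fun _ => psix) (fun _ => psiy) 1 ltac:(lra) Hpsi). }
destruct (circle_action_estimate P Q P_C1 Q_C1 dPQ L L_cont L_deg L_mono) as [C HC].
(* The constant [C] is the same for all iterates, so it disappears after division by n. *)
assert (T : forall n, Rabs (tau P Q (fun p => Nat.iter n g p)
  - (PI / 2 * Nat.iter n L 0 - INR n * disk_int_rect phi)) <= C).
{ intros n.
  rewrite (tau_ext P Q _ (fun p => Nat.iter n (H 1) p)).
  2: { intros p Hp. apply (iter_eq_on _ in_disk g (H 1) n); auto.
       intros q Hq. symmetry. apply (H_ends q Hq). }
  destruct (is_action_iter P Q _ _ _ _ _ _ _ _ n G_disk A)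
    as [a [a' [b [b' [q [q' An]]]]]].
  rewrite (tau_action P Q P_C1 Q_C1 dPQ _ _ _ _ _ _ _ _ An).
  rewrite (disk_int_action_sum P Q _ _ _ _ _ _ _ _ n G_disk G_area A).
  eapply Rle_trans; [|apply (HC n)]. right. f_equal.
  rewrite (RInt_ext_R (fun th => action_sum (H 1) phi n (cos th) (sin th) * circle_density P Q th)
    (fun th => (circle_primitive P Q (Nat.iter n L th) - circle_primitive P Q th)
       * circle_density P Q th)).
  - Rring.
  - intros th _. rewrite (action_sum_circle P Q (H 1) phi L); auto.
    intros s. apply (action_circle h1 h2 f P Q); auto. }
assert (TB : tau_bar P Q g = PI / 2 * ell - disk_int_rect phi).
{ assert (TL := lim_seq_bounded_error (fun n => tau P Q (fun p => Nat.iter n g p))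
    (fun n => Nat.iter n L 0) C ell (disk_int_rect phi) (PI / 2) Hell T).
  unfold tau_bar. now rewrite (is_lim_seq_unique _ _ TL). }
assert (R2 : disk_int_rect phi = 2 * calabi_R f).
{ unfold phi. rewrite (disk_int_action h1 h2 f P Q); auto. f_equal.
  apply RInt_ext_R. intros t _. symmetry. apply disk_int_rectE.
  assert (cf := smooth3_continuous _ f_smooth). cts. }
(* The expression vanishes for the lift [L] of the isotopy, and the translation number of [F]
   exceeds that of [L] by k. *)
exists (- k)%Z.
rewrite (transl_translate F L k ell L_deg Hk Hell), (transl_of_slope L ell Hell), TB, R2, opp_IZR.
field. lra.
Qed.
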